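(* Assume the following hypothesis $(\mathrm{H}_3)$: for every $n\ge3$, every $\rho\in[-1,0]$ and every measurable $f:\mathbb{R}^n\to B^3$, $\mathrm{Stab}_\rho[f]\ge\mathrm{Stab}_\rho[f^{(3)}_{\mathrm{opt}}]$, where $f^{(3)}_{\mathrm{opt}}(x)=(x_1,x_2,x_3)/\|(x_1,x_2,x_3)\|$. Then \[\inf_G\frac{\mathrm{Prod}(G)}{\mathrm{SDP}_{\mathrm{Prod}}(G)}=\alpha_{\mathrm{BOV}},\] the infimum being over all weighted graphs $G$.
   Context: $\mathbf{x}\sim_\rho\mathbf{y}$ are $\rho$-correlated standard Gaussian vectors in $\mathbb{R}^n$ and $\mathrm{Stab}_\rho[f]=\mathbb{E}\langle f(\mathbf{x}),f(\mathbf{y})\rangle$. A weighted graph $G=(V,E,w)$ is a finite undirected graph with nonnegative edge weights summing to $1$; $(\mathbf{u},\mathbf{v})\sim E$ is a random edge. $\mathrm{Prod}(G)=\max_{f:V\to S^2}\mathbb{E}[\tfrac14-\tfrac14\langle f(\mathbf{u}),f(\mathbf{v})\rangle]$ and $\mathrm{SDP}_{\mathrm{Prod}}(G)=\max_{f:V\to S^{|V|-1}}\mathbb{E}[\tfrac14-\tfrac14\langle f(\mathbf{u}),f(\mathbf{v})\rangle]$. $F^*(k,\rho)=\mathbb{E}\langle\mathbf{Z}u/\|\mathbf{Z}u\|,\mathbf{Z}v/\|\mathbf{Z}v\|\rangle$ for unit $u,v$ with $\langle u,v\rangle=\rho$ and $\mathbf{Z}$ a $k\times m$ standard Gaussian matrix;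 $\alpha_{\mathrm{BOV}}=\min_{-1\le\rho<1}\frac{1-F^*(3,\rho)}{1-\rho}$. *)

(* Defs.v *)
From HB Require Import structures.
From mathcomp Require Import all_boot all_order all_algebra.
From mathcomp Require Import all_classical all_reals all_analysis.
Set Implicit Arguments.
Unset Strict Implicit.
Unset Printing Implicit Defensive.
Import Order.TTheory GRing.Theory Num.Theory.
Local Open Scope classical_set_scope.
Local Open Scope ring_scope.

Section Defs.
Context {R : realType}.

(* Vectors of R^n are represented as n-tuples (the tuple type carries the
   product sigma-algebra generated by the coordinates, i.e. the Borel
   sigma-algebra of R^n). *)

Definition dotv {n : nat} (u v : n.-tuple R) : R :=
  \sum_(i < n) tnth u i * tnth v i.

Definition normv {n : nat} (u : n.-tuple R) : R := Num.sqrt (dotv u u).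

Definition lincomb {n : nat} (a : R) (x : n.-tuple R) (b : R) (y : n.-tuple R)
  : n.-tuple R := [tuple a * tnth x i + b * tnth y i | i < n].

(* x / ||x||  (the zero vector is sent to 0; a null set, irrelevant). *)
Definition normalize {n : nat} (x : n.-tuple R) : n.-tuple R :=
  [tuple tnth x i / normv x | i < n].

(* E[g(x)] for x a standard Gaussian vector in R^n: integral with respect to
   the n-fold product of the standard normal law N(0,1), computed as an
   iterated integral over the coordinates. *)
Fixpoint gauss_exp (n : nat) : (n.-tuple R -> R) -> R :=
  match n with
  | 0 => fun g => g [tuple]
  | n'.+1 => fun g =>
      Rintegral (normal_prob 0 1) [set: R]
        (fun t : R => @gauss_exp n' (fun x => g (cons_tuple t x)))
  end.

(* Stab_rho[f] = E <f(x), f(y)> for x ~_rho y standard Gaussian vectors in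
   R^n, realised as y = rho x + sqrt(1 - rho^2) z with x, z independent. *)
Definition Stab (n : nat) (rho : R) (f : n.-tuple R -> 3.-tuple R) : R :=
  @gauss_exp n (fun x => @gauss_exp n (fun z =>
     dotv (f x) (f (lincomb rho x (Num.sqrt (1 - rho ^+ 2)) z)))).

Definition fopt3 (n : nat) (x : n.-tuple R) : 3.-tuple R :=
  normalize [tuple nth 0 x i | i < 3].

Definition H3 : Prop :=
  forall (n : nat), (3 <= n)%N ->
  forall rho : R, -1 <= rho <= 0 ->
  forall f : n.-tuple R -> 3.-tuple R,
    measurable_fun [set: n.-tuple R] f ->
    (forall x, normv (f x) <= 1) ->
    Stab rho (@fopt3 n) <= Stab rho f.

(* F^*(k, rho) = E < Zu/||Zu||, Zv/||Zv|| >, with Z a k x m standard Gaussian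
   matrix and unit u, v with <u,v> = rho.  (The value does not depend on m nor
   on the choice of u, v; we take m = 2, u = e_1,
   v = rho e_1 + sqrt(1-rho^2) e_2, so Z = [c1 c2] with independent standard
   Gaussian columns c1, c2 in R^k, Zu = c1, Zv = rho c1 + sqrt(1-rho^2) c2.) *)
Definition Fstar (k : nat) (rho : R) : R :=
  @gauss_exp k (fun c1 => @gauss_exp k (fun c2 =>
    let Zu := lincomb 1 c1 0 c2 in
    let Zv := lincomb rho c1 (Num.sqrt (1 - rho ^+ 2)) c2 in
    dotv (normalize Zu) (normalize Zv))).

Definition alpha_BOV : R :=
  inf [set (1 - Fstar 3 rho) / (1 - rho) | rho in [set rho : R | -1 <= rho < 1]].

(* A weighted graph on a finite vertex set V: an undirected simple graph with
   nonnegative edge weights summing to 1.  It is encoded by the law of the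
   random (ordered) edge (u,v) ~ E: w u v >= 0, w symmetric, no loops, and
   sum over ordered pairs equal to 1 (edge {u,v} has weight w u v + w v u). *)
Record wgraph (V : finType) := WGraph {
  wt : V -> V -> R;
  wt_ge0 : forall u v, 0 <= wt u v;
  wt_sym : forall u v, wt u v = wt v u;
  wt_noloop : forall u, wt u u = 0;
  wt_sum1 : \sum_(u : V) \sum_(v : V) wt u v = 1
}.

Definition prod_val (V : finType) (G : wgraph V) (d : nat) (f : V -> d.-tuple R)
  : R :=
  \sum_(u : V) \sum_(v : V) wt G u v * (4^-1 - 4^-1 * dotv (f u) (f v)).

Definition Prod (V : finType) (G : wgraph V) : R :=
  sup [set prod_val G f | f in [set f : V -> 3.-tuple R |
                                   forall v, normv (f v) = 1]].

Definition SDP_Prod (V : finType) (G : wgraph V) : R :=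
  sup [set prod_val G f | f in [set f : V -> #|V|.-tuple R |
                                   forall v, normv (f v) = 1]].

Definition ratios : set R :=
  [set r | exists (V : finType) (G : wgraph V), r = Prod G / SDP_Prod G].

End Defs.

(* Main.v *)
(**
Lower bound on the ratio. Round an SDP solution g : V -> S^(m-1) to
v |-> Z g(v) / ||Z g(v)|| with Z a 3 x m Gaussian matrix. Rotation invariance of
the Gaussian measure (a rotation of the plane is a product of shears, which
preserve Lebesgue measure) shows that an edge (u, v) contributes
(1 - Fstar 3 <g u, g v>) / 4 on average, which is at least
alpha_BOV * (1 - <g u, g v>) / 4.

Upper bound, rho in [-1, 0]. Quantize each coordinate of R^n and let G be the law
of the cells of two rho-correlated Gaussian vectors. An assignment V -> S^2 is a
function constant on cells, so H3 bounds Prod G by (1 - Fstar 3 rho) / 4, whereas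
by concentration of the norm the normalized quantized vectors are SDP solutions
of value close to (1 - rho) / 4. Loops have objective 0 at unit vectors, so
deleting them and renormalizing does not change the ratio.

Upper bound, rho in (0, 1). Here Fstar 3 rho <= rho, so the quotient is at least 1,
which already bounds the infimum by the case rho = 0. For an odd Lipschitz h the
noise stability S satisfies S(r)^2 <= S(1) S(r^2) and S(r) = O(r), hence
S(rho) <= rho S(1); apply this to smoothed coordinates of x / ||x||.
*)

(* [H3] speaks of Gaussian space while [ratios] ranges over finite graphs, so a graph on Gaussian
   space has to be discretized. Quantizing one coordinate at a time keeps the coordinates
   independent: the law of a pair of cells is a product over coordinates, and concentration of the
   norm is a variance computation for a sum of n centred terms. This is why [H3] is applied in large
   dimension.

   The SDP value of the hard instance falls short of its ideal by 3 eps: one eps for replacing a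
   coordinate by its quantization, one for the AM-GM step that turns norm deviations into squares,
   one for the variances divided by n.

   [normalize] sends 0 to 0, so rounded vectors are only known to lie in the unit ball. As a graph
   has no loops, the objective is affine in each vertex vector, and moving the vectors one by one to
   the sphere does not decrease it.

   The quotient x / ||x|| is discontinuous at 0. The linear bound on the stability near 0 needs a
   Lipschitz function, hence the smoothing; the final inequality does not involve the Lipschitz
   constant and so survives the limit. *)
Require Import Defs.
From HB Require Import structures.
From mathcomp Require Import all_boot all_order all_algebra.
From mathcomp Require Import all_classical all_reals all_analysis.
From mathcomp Require Import measurable_realfun ring lra.
Set Implicit Arguments.
Unset Strict Implicit.
Unset Printing Implicit Defensive.
Import Order.TTheory GRing.Theory Num.Theory.
Import numFieldNormedType.Exports.
Local Open Scope classical_set_scope.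
Local Open Scope ring_scope.

(** * Expectations of bounded measurable functions *)

Section bounded_measurable.
Context {R : realType}.

(** This class is stable under the operations used below and integrable against every probability
    measure, so linearity, monotonicity and Fubini hold on it without further integrability
    conditions. *)
Definition bmeas d (T : measurableType d) (f : T -> R) : Prop :=
  measurable_fun [set: T] f /\ exists M, forall x, `|f x| <= M.

Lemma bmeas_integrable d (T : measurableType d) (P : probability T R) f :
  bmeas f -> P.-integrable [set: T] (EFin \o f).
Proof.
move=> [mf [M fM]]; apply: measurable_bounded_integrable => //.
- by rewrite (le_lt_trans (probability_le1 P measurableT))// ltry.
- exists M; split; first exact: num_real.
  by move=> y My x _; exact: le_trans (fM x) (ltW My).
Qed.

Lemma bmeas_cst d (T : measurableType d) (c : R) : bmeas (fun _ : T => c).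
Proof. by split; [exact: measurable_cst|exists `|c|]. Qed.

Lemma bmeasD d (T : measurableType d) (f g : T -> R) :
  bmeas f -> bmeas g -> bmeas (fun x => f x + g x).
Proof.
move=> [mf [M fM]] [mg [N gN]]; split; first exact: measurable_funD.
by exists (M + N) => x; rewrite (le_trans (ler_normD _ _))// lerD.
Qed.

Lemma bmeasN d (T : measurableType d) (f : T -> R) :
  bmeas f -> bmeas (fun x => - f x).
Proof.
move=> [mf [M fM]]; split; first exact: measurableT_comp.
by exists M => x; rewrite normrN.
Qed.

Lemma bmeasM d (T : measurableType d) (f g : T -> R) :
  bmeas f -> bmeas g -> bmeas (fun x => f x * g x).
Proof.
move=> [mf [M fM]] [mg [N gN]]; split; first exact: measurable_funM.
by exists (M * N) => x; rewrite normrM ler_pM.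
Qed.

Lemma bmeas_sum d (T : measurableType d) (I : Type) (r : seq I)
    (f : I -> T -> R) :
  (forall i, bmeas (f i)) -> bmeas (fun x => \sum_(i <- r) f i x).
Proof.
move=> bf; elim: r => [|i r IH].
  by under eq_fun do rewrite big_nil; exact: bmeas_cst.
by under eq_fun do rewrite big_cons; exact: bmeasD.
Qed.

Lemma bmeas_prod d (T : measurableType d) (I : Type) (r : seq I)
    (f : I -> T -> R) :
  (forall i, bmeas (f i)) -> bmeas (fun x => \prod_(i <- r) f i x).
Proof.
move=> bf; elim: r => [|i r IH].
  by under eq_fun do rewrite big_nil; exact: bmeas_cst.
by under eq_fun do rewrite big_cons; exact: bmeasM.
Qed.

Lemma bmeas_comp d d' (T : measurableType d) (T' : measurableType d')
    (f : T' -> R) (g : T -> T') :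
  bmeas f -> measurable_fun [set: T] g -> bmeas (fun x => f (g x)).
Proof.
move=> [mf [M fM]] mg; split; first exact: measurableT_comp.
by exists M.
Qed.

Local Notation E P f := (Rintegral P [set: _] f).

Section one_measure.
Context d (T : measurableType d) (P : probability T R).

Lemma expect_cst (c : R) : E P (fun _ => c) = c.
Proof.
by rewrite Rintegral_cst// -[X in fine X]/(P [set: T]) probability_setT mulr1.
Qed.

Lemma eq_expect (f g : T -> R) : f =1 g -> E P f = E P g.
Proof. by move=> fg; apply: eq_Rintegral => x _. Qed.

Lemma expectD (f g : T -> R) : bmeas f -> bmeas g ->
  E P (fun x => f x + g x) = E P f + E P g.
Proof. by move=> bf bg; apply: RintegralD => //; exact: bmeas_integrable. Qed.

Lemma expectZ (c : R) (f : T -> R) : bmeas f ->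
  E P (fun x => c * f x) = c * E P f.
Proof. by move=> bf; apply: RintegralZl => //; exact: bmeas_integrable. Qed.

Lemma expectB (f g : T -> R) : bmeas f -> bmeas g ->
  E P (fun x => f x - g x) = E P f - E P g.
Proof. by move=> bf bg; apply: RintegralB => //; exact: bmeas_integrable. Qed.

Lemma expect_sum (I : Type) (r : seq I) (f : I -> T -> R) :
  (forall i, bmeas (f i)) ->
  E P (fun x => \sum_(i <- r) f i x) = \sum_(i <- r) E P (f i).
Proof.
move=> bf; elim: r => [|i r IH].
  by under eq_expect do rewrite big_nil; rewrite expect_cst big_nil.
under eq_expect do rewrite big_cons.
by rewrite expectD//; [rewrite IH big_cons|exact: bmeas_sum].
Qed.

Lemma le_expect (f g : T -> R) : bmeas f -> bmeas g -> (forall x, f x <= g x) ->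
  E P f <= E P g.
Proof. by move=> bf bg fg; apply: le_Rintegral => //; exact: bmeas_integrable. Qed.

Lemma norm_expect_le (f : T -> R) M : measurable_fun [set: T] f ->
  (forall x, `|f x| <= M) -> `|E P f| <= M.
Proof.
move=> mf fM; have bf : bmeas f by split=> //; exists M.
rewrite (le_trans (le_normr_Rintegral _ (bmeas_integrable P bf)))//.
rewrite -(expect_cst M); apply: le_expect => //.
  split; first exact: measurableT_comp.
  by exists M => x; rewrite normr_id.
exact: bmeas_cst.
Qed.

(** If f were below its mean everywhere, the positive function E f - f would have integral 0 and
    vanish off a null set; as it vanishes nowhere, that null set would be the whole space. *)
Lemma exists_ge_expect (f : T -> R) : bmeas f -> exists x, E P f <= f x.
Proof.
move=> bf; apply: contrapT => /forallNP nf.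
have {nf}lt x : f x < E P f by rewrite ltNge; apply/negP/nf.
have bg : bmeas (fun x => E P f - f x).
  by apply: bmeasD; [exact: bmeas_cst|exact: bmeasN].
have E0 : E P (fun x => E P f - f x) = 0.
  by rewrite expectB ?expect_cst ?subrr//; exact: bmeas_cst.
have mg : measurable_fun [set: T] (EFin \o (fun x => E P f - f x)).
  by apply/measurable_EFinP; case: bg.
have /(ae_eq_integral_abs _ measurableT mg) : (\int[P]_x `|(E P f - f x)%:E| = 0)%E.
  transitivity (\int[P]_x (E P f - f x)%:E)%E.
    by apply: eq_integral => x _; rewrite gee0_abs// lee_fin subr_ge0 ltW.
  rewrite -[LHS]fineK; first by rewrite -[fine _]/(E P _) E0.
  exact: integrable_fin_num (bmeas_integrable P bg).
move=> -[N [mN N0 sub]].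
have : (P N = 1)%E.
  rewrite (_ : N = setT); first exact: probability_setT.
  by apply/seteqP; split=> // x _; apply: sub => /= /(_ I)[]; apply/eqP;
     rewrite gt_eqF// subr_gt0.
by rewrite N0 => /eqP; rewrite eqe eq_sym oner_eq0.
Qed.

End one_measure.

Section pushforward.
Context d d' (T : measurableType d) (T' : measurableType d').

Lemma integrable_expect_pushforward (P : probability T R) (Q : probability T' R)
    (phi : T -> T') (f : T' -> R) :
  measurable_fun [set: T] phi ->
  (forall A, measurable A -> Q A = P (phi @^-1` A)) ->
  measurable_fun [set: T'] f -> P.-integrable [set: T] (EFin \o (f \o phi)) ->
  E Q f = E P (fun x => f (phi x)).
Proof.
move=> mphi QP mf fi; rewrite /Rintegral; congr fine.
rewrite (eq_measure_integral (pushforward P phi))//; last first.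
  by move=> A mA _; exact: QP.
rewrite integral_pushforward ?preimage_setT//=.
by apply/measurable_EFinP.
Qed.

Lemma expect_pushforward (P : probability T R) (Q : probability T' R)
    (phi : T -> T') (f : T' -> R) :
  measurable_fun [set: T] phi ->
  (forall A, measurable A -> Q A = P (phi @^-1` A)) ->
  bmeas f -> E Q f = E P (fun x => f (phi x)).
Proof.
move=> mphi QP bf; apply: integrable_expect_pushforward => //; first by case: bf.
exact: bmeas_integrable (bmeas_comp bf mphi).
Qed.

End pushforward.

Section fubini.
Context d d' (T : measurableType d) (T' : measurableType d').
Variables (P : probability T R) (Q : probability T' R).

Lemma bmeas_section (f : T * T' -> R) x : bmeas f -> bmeas (fun y => f (x, y)).
Proof. by move=> bf; apply: (bmeas_comp bf); exact: pair1_measurable. Qed.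

Lemma bmeas_section2 (f : T * T' -> R) y : bmeas f -> bmeas (fun x => f (x, y)).
Proof. by move=> bf; apply: (bmeas_comp bf); exact: pair2_measurable. Qed.

Lemma bmeas_expect (f : T * T' -> R) : bmeas f ->
  bmeas (fun x => E Q (fun y => f (x, y))).
Proof.
move=> bf; split; last first.
  have [mf [M fM]] := bf; exists M => x; apply: norm_expect_le => //.
  by case: (bmeas_section x bf).
apply: (measurableT_comp (f := fine)); first exact: fine_measurable.
(* The section integral involves [Q] alone; a Dirac mass fills the place of the first measure. *)
exact: (measurable_fubini_F (m1 := dirac (point : T)) (m2 := Q)
  (bmeas_integrable _ bf)).
Qed.

Lemma expect_prod (f : T * T' -> R) : bmeas f ->
  E (P \x Q)%E f = E P (fun x => E Q (fun y => f (x, y))).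
Proof.
move=> bf; rewrite /Rintegral; congr fine.
rewrite -integral12_prod_meas1; last exact: bmeas_integrable.
apply: eq_integral => x _; rewrite fineK//.
apply: integrable_fin_num => //; exact: (bmeas_integrable Q (bmeas_section x bf)).
Qed.

Lemma expect_swap (f : T * T' -> R) : bmeas f ->
  E P (fun x => E Q (fun y => f (x, y))) =
  E Q (fun y => E P (fun x => f (x, y))).
Proof.
move=> bf; rewrite -expect_prod// /Rintegral; congr fine.
rewrite -integral21_prod_meas1; last exact: bmeas_integrable.
apply: eq_integral => x _; rewrite fineK//.
apply: integrable_fin_num => //; exact: (bmeas_integrable P (bmeas_section2 x bf)).
Qed.

End fubini.
End bounded_measurable.
Notation "'\E' P f" := (Rintegral P [set: _] f) (at level 10, P at level 9, f at level 9).

(** * Powers of a probability law on tuples *)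

Section tuple_probability.
Context {R : realType} d (T : measurableType d) (P : probability T R).

Definition cons_pair n (p : T * n.-tuple T) : n.+1.-tuple T :=
  cons_tuple p.1 p.2.

Lemma measurable_cons_pair n : measurable_fun [set: T * n.-tuple T] (@cons_pair n).
Proof. by apply: measurable_cons. Qed.

HB.instance Definition _ n := isMeasurableFun.Build _ _ _ _ (@cons_pair n)
  (@measurable_cons_pair n).

(** The recursion mirrors [gauss_exp]. The base type is arbitrary so that the same construction
    gives Gaussian vectors (over R) and Gaussian matrices (over the space of columns). *)
Fixpoint tuple_prob n : probability (n.-tuple T) R :=
  match n with
  | 0 => dirac ([tuple] : 0.-tuple T)
  | n'.+1 => distribution (P \x tuple_prob n')%E (@cons_pair n')
  end.

Lemma expect_tuple_prob0 (f : 0.-tuple T -> R) : bmeas f ->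
  \E (tuple_prob 0) f = f [tuple].
Proof.
move=> [mf _]; rewrite /Rintegral /= integral_dirac ?diracT ?mul1e//.
by apply/measurable_EFinP.
Qed.

Lemma bmeas_cons n (f : n.+1.-tuple T -> R) : bmeas f ->
  bmeas (fun p : T * n.-tuple T => f (cons_tuple p.1 p.2)).
Proof. by move=> bf; apply: (bmeas_comp bf); exact: measurable_cons_pair. Qed.

Lemma expect_tuple_probS n (f : n.+1.-tuple T -> R) : bmeas f ->
  \E (tuple_prob n.+1) f =
  \E P (fun t => \E (tuple_prob n) (fun x => f (cons_tuple t x))).
Proof.
move=> bf; rewrite (expect_pushforward (P := (P \x tuple_prob n)%E)
  (@measurable_cons_pair n) _ bf)//.
by rewrite expect_prod//; exact: (bmeas_cons bf).
Qed.

End tuple_probability.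

(** * The standard Gaussian law and its density *)

Section gauss.
Context {R : realType}.

Definition gauss1 : probability (measurableTypeR R) R := normal_prob 0 1.

Definition gauss n : probability (n.-tuple (measurableTypeR R)) R :=
  tuple_prob gauss1 n.

Lemma gauss_expE n (g : n.-tuple R -> R) : bmeas g ->
  gauss_exp g = \E (gauss n) g.
Proof.
elim: n g => [g bg|n IH g bg]; first by rewrite expect_tuple_prob0.
rewrite expect_tuple_probS//=; apply: eq_Rintegral => t _.
by rewrite IH//; exact: (bmeas_section t (bmeas_cons bg)).
Qed.

Lemma gauss_exp_cst n (c : R) : @gauss_exp R n (fun _ => c) = c.
Proof.
by rewrite gauss_expE; [exact: expect_cst|exact: bmeas_cst].
Qed.

Lemma eq_gauss_exp n (f g : n.-tuple R -> R) : f =1 g ->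
  gauss_exp f = gauss_exp g.
Proof. by move=> fg; congr gauss_exp; apply/funext. Qed.

Local Open Scope ereal_scope.

(** The Radon-Nikodym density and [normal_pdf] have the same integral over every measurable set,
    hence agree almost everywhere. *)
Lemma ge0_integral_normal_prob (f : R -> \bar R) :
  measurable_fun [set: R] f -> (forall x, 0 <= f x) ->
  \int[normal_prob 0 1]_x f x =
  \int[@lebesgue_measure R]_x (f x * (normal_pdf 0 1 x)%:E).
Proof.
move=> mf f0; pose g := Radon_Nikodym_SigmaFinite.f gauss1 (@lebesgue_measure R).
have dom : gauss1 `<< (@lebesgue_measure R) := normal_prob_dominates 0 1.
have mp : measurable_fun [set: measurableTypeR R]
    (fun x : measurableTypeR R => (normal_pdf 0 1 x)%:E).
  by apply/measurable_EFinP; exact: measurable_normal_pdf.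
rewrite -(Radon_Nikodym_SigmaFinite.change_of_variables (nu := gauss1) dom)//.
apply: ge0_ae_eq_integral => //.
- apply: emeasurable_funM => //.
  exact: measurable_int (Radon_Nikodym_SigmaFinite.f_integrable _).
- exact: emeasurable_funM.
- move=> x _; rewrite mule_ge0//; exact: Radon_Nikodym_SigmaFinite.f_ge0.
- by move=> x _; rewrite mule_ge0// lee_fin normal_pdf_ge0.
- apply: ae_eqe_mul2l; apply: integral_ae_eq => //.
  + exact: Radon_Nikodym_SigmaFinite.f_integrable.
  + move=> E _ mE; rewrite -Radon_Nikodym_SigmaFinite.f_integral//.
Qed.

(** The image of Lebesgue measure under a translation gives intervals their length, so uniqueness
    identifies it with Lebesgue measure. *)
Lemma ge0_integral_lebesgue_shift (k : R) (f : R -> \bar R) :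
  measurable_fun [set: R] f -> (forall x, 0 <= f x) ->
  \int[@lebesgue_measure R]_x f (x + k)%R = \int[@lebesgue_measure R]_x f x.
Proof.
move=> mf f0.
have mk : measurable_fun [set: measurableTypeR R] (fun x : measurableTypeR R => (x + k)%R : measurableTypeR R).
  exact: measurable_funD.
rewrite [RHS](eq_measure_integral (pushforward (@lebesgue_measure R) (fun x : measurableTypeR R => (x + k)%R : measurableTypeR R))).
  by rewrite ge0_integral_pushforward.
move=> A mA _; apply: lebesgue_measure_unique => //= X [[a b] /= _ <-].
rewrite /pushforward.
rewrite (_ : _ @^-1` _ = `](a - k)%R, (b - k)%R]%classic); last first.
  by apply/seteqP; split => x /=; rewrite !in_itv /= ltrBlDr lerBrDr.
rewrite !lebesgue_measure_itv /= !lte_fin ltrD2r.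
by case: ifP => // _; rewrite -!EFinB opprB addrA subrK.
Qed.

End gauss.

(** * Rotation invariance of Gaussian measures *)

Section rotation.
Context {R : realType}.
Local Notation mR := (measurableTypeR R).
Local Notation lam := (@lebesgue_measure R).

Section lebesgue.
Local Open Scope ereal_scope.

(** After exchanging the integrals, the shear is, at fixed y, a translation of x by k y. *)
Lemma ge0_integral_shear1 (k : R) (H : mR * mR -> \bar R) :
  measurable_fun [set: mR * mR] H -> (forall p, 0 <= H p) ->
  \int[lam]_x \int[lam]_y H (x + k * y, y)%R = \int[lam]_x \int[lam]_y H (x, y).
Proof.
move=> mH H0.
have mS : measurable_fun [set: mR * mR]
    (fun p : mR * mR => ((p.1 + k * p.2)%R : mR, p.2)).
  apply: measurable_fun_pair => //=; apply: measurable_funD => //.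
  by apply: measurable_funM.
transitivity (\int[lam]_y \int[lam]_x H (x + k * y, y)%R).
  apply: (fubini_tonelli (fun p : mR * mR => H ((p.1 + k * p.2)%R : mR, p.2))).
  - exact: (measurableT_comp mH mS).
  - by move=> p; exact: H0.
transitivity (\int[lam]_y \int[lam]_x H (x, y));
  last exact: (esym (fubini_tonelli H mH H0)).
apply: eq_integral => y _.
apply: (ge0_integral_lebesgue_shift (k * y) (f := fun x => H (x, y))) => //.
exact: (measurableT_comp mH (pair2_measurable y)).
Qed.

Lemma ge0_integral_shear2 (k : R) (H : mR * mR -> \bar R) :
  measurable_fun [set: mR * mR] H -> (forall p, 0 <= H p) ->
  \int[lam]_x \int[lam]_y H (x, y + k * x)%R = \int[lam]_x \int[lam]_y H (x, y).
Proof.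
move=> mH H0; apply: eq_integral => x _.
apply: (ge0_integral_lebesgue_shift (k * x) (f := fun y => H (x, y))) => //.
exact: (measurableT_comp mH (pair1_measurable x)).
Qed.

(* For s <> 0 a rotation is a product of three shears, and the rotation by pi
   is the square of the rotation by pi/2. *)
Lemma ge0_integral_rotation (c s : R) (H : mR * mR -> \bar R) :
  (c ^+ 2 + s ^+ 2 = 1)%R ->
  measurable_fun [set: mR * mR] H -> (forall p, 0 <= H p) ->
  \int[lam]_x \int[lam]_y H (c * x - s * y, s * x + c * y)%R =
  \int[lam]_x \int[lam]_y H (x, y).
Proof.
have rot_neq0 (c0 s0 : R) (H0 : mR * mR -> \bar R) :
    (c0 ^+ 2 + s0 ^+ 2 = 1)%R -> s0 != 0%R ->
    measurable_fun [set: mR * mR] H0 -> (forall p, 0 <= H0 p) ->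
    \int[lam]_x \int[lam]_y H0 (c0 * x - s0 * y, s0 * x + c0 * y)%R =
    \int[lam]_x \int[lam]_y H0 (x, y).
  move=> cs s0n mH H0ge0.
  (* For an angle theta this is -tan(theta / 2), the parameter of the two outer shears. *)
  pose p := ((c0 - 1) / s0)%R.
  have mS1 : measurable_fun [set: mR * mR]
      (fun q : mR * mR => ((q.1 + p * q.2)%R : mR, q.2)).
    apply: measurable_fun_pair => //=; apply: measurable_funD => //.
    by apply: measurable_funM.
  have mS2 : measurable_fun [set: mR * mR]
      (fun q : mR * mR => (q.1, (q.2 + s0 * q.1)%R : mR)).
    apply: measurable_fun_pair => //=; apply: measurable_funD => //.
    by apply: measurable_funM.
  pose H1 := fun q : mR * mR => H0 ((q.1 + p * q.2)%R : mR, q.2).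
  have mH1 : measurable_fun setT H1 by exact: (measurableT_comp mH mS1).
  have H1ge0 q : 0 <= H1 q by exact: H0ge0.
  pose H2 := fun q : mR * mR => H1 (q.1, (q.2 + s0 * q.1)%R : mR).
  have mH2 : measurable_fun setT H2 by exact: (measurableT_comp mH1 mS2).
  have H2ge0 q : 0 <= H2 q by exact: H1ge0.
  apply: etrans (ge0_integral_shear1 p mH H0ge0).
  apply: etrans (ge0_integral_shear2 s0 mH1 H1ge0).
  apply: etrans (ge0_integral_shear1 p mH2 H2ge0).
  apply: eq_integral => x _; apply: eq_integral => y _.
  rewrite /H2 /H1 /=; congr (H0 (_, _)).
  - have e : (s0 ^+ 2 = 1 - c0 ^+ 2)%R by rewrite -cs; ring.
    transitivity (c0 * x - s0 ^+ 2 / s0 * y)%R; first by field.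
    by rewrite e /p; field.
  - by rewrite /p; field.
move=> cs mH H0.
have [s0|s0] := eqVneq s 0%R; last exact: rot_neq0.
have /eqP : (c ^+ 2 = 1 ^+ 2)%R by rewrite expr1n -cs s0; ring.
rewrite eqf_sqr => /orP[] /eqP ->; rewrite s0.
  by apply: eq_integral => x _; apply: eq_integral => y _; congr (H (_, _)); ring.
have mrot : measurable_fun [set: mR * mR]
    (fun q : mR * mR => ((0 * q.1 - 1 * q.2)%R : mR, (1 * q.1 + 0 * q.2)%R : mR)).
  by apply: measurable_fun_pair => //=;
    [apply: measurable_funB|apply: measurable_funD] => //; apply: measurable_funM.
pose H1 := fun q : mR * mR =>
  H ((0 * q.1 - 1 * q.2)%R : mR, (1 * q.1 + 0 * q.2)%R : mR).
have mH1 : measurable_fun setT H1 by exact: (measurableT_comp mH mrot).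
have H1ge0 q : 0 <= H1 q by exact: H0.
have cs1 : ((0 : R) ^+ 2 + 1 ^+ 2 = 1)%R by ring.
apply: etrans (rot_neq0 0%R 1%R H cs1 (oner_neq0 _) mH H0).
apply: etrans (rot_neq0 0%R 1%R H1 cs1 (oner_neq0 _) mH1 H1ge0).
by apply: eq_integral => x _; apply: eq_integral => y _; rewrite /H1 /=;
  congr (H (_, _)); ring.
Qed.

Lemma measurable_rotation (c s : R) : measurable_fun [set: mR * mR]
  (fun q : mR * mR => ((c * q.1 - s * q.2)%R : mR, (s * q.1 + c * q.2)%R : mR)).
Proof.
by apply: measurable_fun_pair => //=;
  [apply: measurable_funB|apply: measurable_funD] => //; apply: measurable_funM.
Qed.

(** The density of a pair of independent Gaussians depends on x^2 + y^2 only, so the Lebesgue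
    statement applies to H times this density. *)
Lemma ge0_integral_gauss1_rotation (c s : R) (H : mR * mR -> \bar R) :
  (c ^+ 2 + s ^+ 2 = 1)%R ->
  measurable_fun [set: mR * mR] H -> (forall p, 0 <= H p) ->
  \int[gauss1]_x \int[gauss1]_y H (c * x - s * y, s * x + c * y)%R =
  \int[gauss1]_x \int[gauss1]_y H (x, y).
Proof.
move=> cs mH H0.
have mp : measurable_fun [set: mR] (fun x : mR => (normal_pdf 0 1 x)%:E : \bar R).
  by apply/measurable_EFinP; exact: measurable_normal_pdf.
have dens (G : mR * mR -> \bar R) : measurable_fun [set: mR * mR] G ->
    (forall p, 0 <= G p) ->
    \int[gauss1]_x \int[gauss1]_y G (x, y) = \int[lam]_x \int[lam]_y
      (G (x, y) * ((normal_pdf 0 1 x)%:E * (normal_pdf 0 1 y)%:E)).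
  move=> mG G0; rewrite ge0_integral_normal_prob; first last.
  - by move=> x; apply: integral_ge0.
  - exact: (measurable_fun_fubini_tonelli_F G).
  apply: eq_integral => x _.
  have mGx : measurable_fun [set: mR] (fun y => G (x, y)).
    exact: (measurableT_comp mG (pair1_measurable x)).
  rewrite ge0_integral_normal_prob//.
  rewrite -ge0_integralZr//; first last.
  - by rewrite lee_fin normal_pdf_ge0.
  - by move=> y _; rewrite mule_ge0// lee_fin normal_pdf_ge0.
  - exact: emeasurable_funM.
  by apply: eq_integral => y _; rewrite -muleA (muleC (normal_pdf 0 1 y)%:E).
pose G := fun q => H q * ((normal_pdf 0 1 q.1)%:E * (normal_pdf 0 1 q.2)%:E).
pose Hr := fun q : mR * mR =>
  H ((c * q.1 - s * q.2)%R : mR, (s * q.1 + c * q.2)%R : mR).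
have mHr : measurable_fun setT Hr.
  exact: (measurableT_comp mH (measurable_rotation c s)).
have Hr0 q : 0 <= Hr q by exact: H0.
apply: etrans (dens Hr mHr Hr0) _.
apply: etrans (esym (dens H mH H0)).
apply: etrans (ge0_integral_rotation (H := G) cs _ _).
- apply: eq_integral => x _; apply: eq_integral => y _.
  rewrite /G /Hr /=; congr (_ * _).
  rewrite -!EFinM; congr EFin; rewrite !normal_pdfE ?oner_eq0//.
  rewrite /normal_fun mulrACA [RHS]mulrACA; congr (_ * _)%R.
  rewrite -!expRD; congr expR.
  rewrite !subr0 !mulNr -!opprD -!mulrDl; congr (- (_ / _))%R.
  by rewrite -[LHS]mul1r -cs; ring.
- by apply: emeasurable_funM => //; apply: emeasurable_funM;
    apply: (measurableT_comp mp).
- by move=> p; rewrite !mule_ge0// lee_fin normal_pdf_ge0.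
Qed.

(** On indicators, the statement for nonnegative functions becomes an equality of measures, from
    which signed functions follow by change of variables. *)
Lemma gauss1_rotation (c s : R) (A : set (mR * mR)) :
  (c ^+ 2 + s ^+ 2 = 1)%R -> measurable A ->
  (gauss1 \x gauss1) A = (gauss1 \x gauss1)
    ((fun q : mR * mR => ((c * q.1 - s * q.2)%R : mR, (s * q.1 + c * q.2)%R : mR)) @^-1` A).
Proof.
move=> cs mA; set rot := fun q : mR * mR => _.
have mrot : measurable_fun setT rot := measurable_rotation c s.
have mrA : measurable (rot @^-1` A) by rewrite -[_ @^-1` _]setTI; exact: mrot.
have E B : measurable B -> (gauss1 \x gauss1) B =
    \int[gauss1]_x \int[gauss1]_y (\1_B (x, y) : R)%:E.
  move=> mB; transitivity (\int[gauss1 \x gauss1]_q (\1_B q : R)%:E).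
    by symmetry; apply: etrans (integral_indic _ measurableT mB) _; rewrite setIT.
  apply: (fubini_tonelli1 (fun q => (\1_B q : R)%:E)).
  - by apply/measurable_EFinP; exact: measurable_indic.
  - by move=> q; rewrite lee_fin.
apply: etrans (E _ mA) _; apply: etrans (esym (E _ mrA)).
symmetry; apply: (ge0_integral_gauss1_rotation (H := fun q => (\1_A q : R)%:E)) => //.
by apply/measurable_EFinP; exact: measurable_indic.
Qed.

End lebesgue.

Lemma expect_gauss1_rotation (c s : R) (f : mR * mR -> R) :
  c ^+ 2 + s ^+ 2 = 1 -> bmeas f ->
  \E gauss1 (fun x => \E gauss1 (fun y => f (c * x - s * y, s * x + c * y))) =
  \E gauss1 (fun x => \E gauss1 (fun y => f (x, y))).
Proof.
move=> cs bf; rewrite -expect_prod//.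
rewrite (expect_pushforward (P := (gauss1 \x gauss1)%E) (measurable_rotation c s) _ bf).
  by rewrite expect_prod//; exact: (bmeas_comp bf (measurable_rotation c s)).
by move=> A; exact: gauss1_rotation.
Qed.

Lemma lincomb_cons n (a b t u : R) (x y : n.-tuple R) :
  lincomb a (cons_tuple t x) b (cons_tuple u y) =
  cons_tuple (a * t + b * u) (lincomb a x b y).
Proof.
apply: eq_from_tnth => i; rewrite tnth_mktuple.
case: (unliftP ord0 i) => [j ->|->]; last by rewrite !tnth0.
by rewrite !tnthS tnth_mktuple.
Qed.

Lemma measurable_lincomb d (T : measurableType d) n (a b : R)
    (f g : T -> n.-tuple mR) :
  measurable_fun setT f -> measurable_fun setT g ->
  measurable_fun setT (fun x => lincomb a (f x) b (g x) : n.-tuple mR).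
Proof.
move=> mf mg; apply/measurable_fun_tnthP => i.
rewrite (_ : _ \o _ = fun x => a * tnth (f x) i + b * tnth (g x) i); last first.
  by apply/funext => x /=; rewrite tnth_mktuple.
by apply: measurable_funD; apply: measurable_funM => //;
  [apply: (measurableT_comp (measurable_tnth i) mf)|
   apply: (measurableT_comp (measurable_tnth i) mg)].
Qed.

Local Notation V n := (n.-tuple mR).

(** The rotation mixes x and y coordinate by coordinate, with the same angle in each. Once the
    integrals over the two first coordinates are moved outermost, the planar case treats them and
    induction treats the tails. *)
Lemma expect_gauss_rotation n (c s : R) (f : V n * V n -> R) :
  c ^+ 2 + s ^+ 2 = 1 -> bmeas f ->
  \E (gauss n) (fun x => \E (gauss n) (fun y =>
    f (lincomb c x (- s) y, lincomb s x c y))) =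
  \E (gauss n) (fun x => \E (gauss n) (fun y => f (x, y))).
Proof.
move=> cs; elim: n f => [|n IH] f bf.
  by apply: eq_expect => x; apply: eq_expect => y; congr (f (_, _));
     apply: eq_from_tnth; case.
have expS (F : V n.+1 * V n.+1 -> R) : bmeas F ->
    \E (gauss n.+1) (fun x => \E (gauss n.+1) (fun y => F (x, y))) =
    \E gauss1 (fun t => \E gauss1 (fun u => \E (gauss n) (fun x =>
      \E (gauss n) (fun y => F (cons_tuple t x, cons_tuple u y))))).
  move=> bF; rewrite expect_tuple_probS; last exact: (bmeas_expect _ bF).
  apply: eq_expect => t.
  have bG : bmeas (fun q : (V n * mR) * V n =>
      F (cons_tuple t q.1.1, cons_tuple q.1.2 q.2)).
    apply: (bmeas_comp bF); apply: measurable_fun_pair;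
      apply: measurable_cons => //; exact: measurableT_comp.
  transitivity (\E (gauss n) (fun x => \E gauss1 (fun u =>
      \E (gauss n) (fun y => F (cons_tuple t x, cons_tuple u y))))).
    apply: eq_expect => x.
    by rewrite expect_tuple_probS//; exact: (bmeas_section (cons_tuple t x) bF).
  exact: (expect_swap _ _ (bmeas_expect (gauss n) bG)).
have brot : bmeas (fun q : V n.+1 * V n.+1 =>
    f (lincomb c q.1 (- s) q.2, lincomb s q.1 c q.2)).
  by apply: (bmeas_comp bf); apply: measurable_fun_pair; apply: measurable_lincomb.
rewrite (expS _ brot) (expS _ bf).
have bG : bmeas (fun q : (mR * mR) * (V n * V n) =>
    f (cons_tuple q.1.1 q.2.1, cons_tuple q.1.2 q.2.2)).
  by apply: (bmeas_comp bf); apply: measurable_fun_pair;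
     apply: measurable_cons => //; exact: measurableT_comp.
pose G q := \E (gauss n) (fun x => \E (gauss n) (fun y =>
  f (cons_tuple q.1 x, cons_tuple q.2 y))).
have bGG : bmeas (G : mR * mR -> R).
  rewrite (_ : G = fun q => \E (gauss n \x gauss n)%E (fun p : V n * V n =>
      f (cons_tuple q.1 p.1, cons_tuple q.2 p.2))).
    exact: (bmeas_expect _ bG).
  by apply/funext => q; rewrite (expect_prod _ _ (bmeas_section q bG)).
apply: etrans _ (expect_gauss1_rotation cs bGG).
apply: eq_expect => t; apply: eq_expect => u.
apply: etrans _ (IH _ (bmeas_section (c * t - s * u, s * t + c * u) bG)).
by apply: eq_expect => x; apply: eq_expect => y; rewrite !lincomb_cons mulNr.
Qed.

End rotation.

(** * Images of unit vectors under a Gaussian matrix *)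

Section linear_images.
Context {R : realType}.
Local Notation mR := (measurableTypeR R).
Local Notation V n := (n.-tuple mR).

(** The product Z u, with the k x m matrix Z stored as the tuple of its columns. *)
Definition colcomb k m (u : m.-tuple R) (Z : m.-tuple (V k)) : V k :=
  [tuple \sum_(j < m) tnth u j * tnth (tnth Z j) i | i < k].

Lemma colcomb_cons k m a (u : m.-tuple R) t (Z : m.-tuple (V k)) :
  colcomb (cons_tuple a u) (cons_tuple t Z) = lincomb a t 1 (colcomb u Z).
Proof.
apply: eq_from_tnth => i; rewrite !tnth_mktuple big_ord_recl !tnth0 mul1r.
by congr (_ + _); apply: eq_bigr => j _; rewrite !tnthS.
Qed.

Lemma measurable_colcomb k m (u : m.-tuple R) :
  measurable_fun [set: m.-tuple (V k)] (colcomb u).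
Proof.
apply/measurable_fun_tnthP => i.
rewrite (_ : _ \o _ = fun Z => \sum_(j < m) tnth u j * tnth (tnth Z j) i); last first.
  by apply/funext => x /=; rewrite tnth_mktuple.
apply: measurable_sum => j; apply: measurable_funM => //.
exact: (measurableT_comp (measurable_tnth i) (measurable_tnth j)).
Qed.

Lemma dotv_cons n (a b : R) (u v : n.-tuple R) :
  dotv (cons_tuple a u) (cons_tuple b v) = a * b + dotv u v.
Proof.
rewrite /dotv big_ord_recl !tnth0; congr (_ + _).
by apply: eq_bigr => j _; rewrite !tnthS.
Qed.

(** Polar coordinates in the plane; at the origin the angle is arbitrary and taken to be 0. *)
Lemma givens (p q : R) : exists r c s,
  [/\ 0 <= r, c ^+ 2 + s ^+ 2 = 1, p = r * c & q = r * s].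
Proof.
have [pq0|pq0] := eqVneq (p ^+ 2 + q ^+ 2) 0.
  have /andP[/eqP p0 /eqP q0] : (p == 0) && (q == 0).
    by move/eqP: pq0; rewrite paddr_eq0 ?sqr_ge0// !sqrf_eq0.
  by exists 0, 1, 0; rewrite p0 q0 !mul0r; split=> //; ring.
have h : 0 <= p ^+ 2 + q ^+ 2 by rewrite addr_ge0 ?sqr_ge0.
pose r := Num.sqrt (p ^+ 2 + q ^+ 2).
have r2 : r ^+ 2 = p ^+ 2 + q ^+ 2 by rewrite sqr_sqrtr.
have r0 : r != 0 by apply: contraNneq pq0 => r0; rewrite -r2 r0 expr0n.
exists r, (p / r), (q / r); split; rewrite ?sqrtr_ge0//.
- by rewrite !expr_div_n -mulrDl -r2 divff// sqrf_eq0.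
- by rewrite mulrC mulfVK.
- by rewrite mulrC mulfVK.
Qed.

(* (a, 0; b, c) is the Cholesky factor of the Gram matrix of (u, v); adding a
   column costs one Givens rotation to clear each of the two new entries. *)
Lemma expect_colcomb_cholesky k m (u v : m.-tuple R) : exists a b c,
  [/\ 0 <= a, 0 <= c, [/\ a ^+ 2 = dotv u u, a * b = dotv u v &
      b ^+ 2 + c ^+ 2 = dotv v v] &
   forall f : V k * V k -> R, bmeas f ->
   \E (tuple_prob (gauss k) m) (fun Z => f (colcomb u Z, colcomb v Z)) =
   \E (gauss k) (fun x => \E (gauss k) (fun y =>
     f (lincomb a x 0 y, lincomb b x c y)))].
Proof.
elim: m u v => [|m IH] u v.
  exists 0, 0, 0; rewrite /dotv !big_ord0 !mul0r expr0n addr0; split=> // f bf.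
  transitivity (f ([tuple 0 | i < k], [tuple 0 | i < k])).
    rewrite expect_tuple_prob0; last first.
      apply: (bmeas_comp bf); apply: measurable_fun_pair; exact: measurable_colcomb.
    by congr (f (_, _)); apply: eq_from_tnth => i; rewrite !tnth_mktuple big_ord0.
  rewrite -[LHS](expect_cst (gauss k)); apply: eq_expect => x.
  rewrite -[LHS](expect_cst (gauss k)); apply: eq_expect => y.
  by congr (f (_, _)); apply: eq_from_tnth => i; rewrite !tnth_mktuple !mul0r addr0.
case/tupleP: u => u0 u; case/tupleP: v => v0 v.
have [a [b [c [a0 c0 [auu abuv bcvv] H]]]] := IH u v.
have [a' [c1 [s1 [a'0 cs1 u0E aE]]]] := givens u0 a.
(* The rotation that merges u0 and a into a' turns (v0, b) into (b', d); a second rotation then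
   merges the stray entry d with c into c'. *)
pose b' := v0 * c1 + b * s1; pose d := b * c1 - v0 * s1.
have [c' [c2 [s2 [c'0 cs2 dE cE]]]] := givens d c.
exists a', b', c'; split => //.
  rewrite !dotv_cons -auu -abuv -bcvv; split.
  - by rewrite u0E aE -[LHS]mulr1 -cs1; ring.
  - by rewrite u0E aE /b'; ring.
  - have <- : d ^+ 2 + c ^+ 2 = c' ^+ 2 by rewrite dE cE -[RHS]mulr1 -cs2; ring.
    have e : b' ^+ 2 + d ^+ 2 = v0 ^+ 2 + b ^+ 2.
      by rewrite -[RHS]mulr1 -cs1 /b' /d; ring.
    by rewrite addrA e; ring.
move=> f bf.
have mcons : measurable_fun [set: m.+1.-tuple (V k)]
    (fun Z => (colcomb (cons_tuple u0 u) Z, colcomb (cons_tuple v0 v) Z)).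
  by apply: measurable_fun_pair; exact: measurable_colcomb.
rewrite expect_tuple_probS; last exact: (bmeas_comp bf mcons).
have bt t : bmeas (fun q : V k * V k => f (lincomb u0 t 1 q.1, lincomb v0 t 1 q.2)).
  by apply: (bmeas_comp bf); apply: measurable_fun_pair; exact: measurable_lincomb.
transitivity (\E (gauss k) (fun t => \E (gauss k) (fun x => \E (gauss k) (fun y =>
    f (lincomb u0 t a x, lincomb 1 (lincomb v0 t b x) c y))))).
  apply: eq_expect => t; under eq_expect do rewrite !colcomb_cons.
  rewrite (H _ (bt t)); apply: eq_expect => x; apply: eq_expect => y.
  by congr (f (_, _)); apply: eq_from_tnth => i; rewrite !tnth_mktuple; ring.
have bG : bmeas (fun q : (V k * V k) * V k =>
    f (lincomb u0 q.1.1 a q.1.2, lincomb 1 (lincomb v0 q.1.1 b q.1.2) c q.2)).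
  apply: (bmeas_comp bf); apply: measurable_fun_pair; apply: measurable_lincomb;
    rewrite //; try exact: measurableT_comp.
  by apply: measurable_lincomb; exact: measurableT_comp.
apply: etrans (esym (expect_gauss_rotation cs1 (bmeas_expect (gauss k) bG))) _.
apply: eq_expect => t.
pose K (q : V k * V k) := f (lincomb a' t 0 t,
  lincomb 1 (lincomb b' t d q.1) c q.2).
have bK : bmeas K.
  apply: (bmeas_comp bf); apply: measurable_fun_pair => //.
  by apply: measurable_lincomb => //; exact: measurable_lincomb.
transitivity (\E (gauss k) (fun x => \E (gauss k) (fun y => K (x, y)))).
  apply: eq_expect => x; apply: eq_expect => y; rewrite /K /=.
  congr (f (_, _)); apply: eq_from_tnth => i; rewrite !tnth_mktuple.
  - rewrite mul0r addr0 -[in RHS](mulr1 a') -cs1 u0E aE; ring.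
  - by rewrite /b' /d; ring.
apply: etrans (esym (expect_gauss_rotation cs2 bK)) _.
(* The second rotation has cleared the coefficient of the last vector, so both integrands are free
   of the variable that is integrated differently on the two sides. *)
apply: eq_expect => x; rewrite -[RHS](expect_cst (gauss k)).
apply: eq_expect => y; rewrite /K /=.
congr (f (_, _)); apply: eq_from_tnth => i; rewrite !tnth_mktuple; first by ring.
by rewrite mul1r -[in RHS](mulr1 c') -cs2 dE cE; ring.
Qed.

Lemma dotv_ge0 n (u : n.-tuple R) : 0 <= dotv u u.
Proof. by apply: sumr_ge0 => i _; rewrite -expr2 sqr_ge0. Qed.

Lemma normv_sqr n (u : n.-tuple R) : normv u ^+ 2 = dotv u u.
Proof. by rewrite sqr_sqrtr// dotv_ge0. Qed.

Lemma normv1_dotv n (u : n.-tuple R) : normv u = 1 -> dotv u u = 1.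
Proof. by move=> u1; rewrite -normv_sqr u1 expr1n. Qed.

(** For unit vectors the signs of the diagonal force the Cholesky factor to be a = 1, b = <u, v>, c
    = sqrt(1 - b^2). Hence (Z u, Z v) is a correlated Gaussian pair whose law depends on <u, v>
    alone. *)
Lemma expect_colcomb k m (u v : m.-tuple R) (f : V k * V k -> R) :
  normv u = 1 -> normv v = 1 -> bmeas f ->
  \E (tuple_prob (gauss k) m) (fun Z => f (colcomb u Z, colcomb v Z)) =
  \E (gauss k) (fun x => \E (gauss k) (fun y =>
    f (x, lincomb (dotv u v) x (Num.sqrt (1 - dotv u v ^+ 2)) y))).
Proof.
move=> /normv1_dotv u1 /normv1_dotv v1 bf.
have [a [b [c [a0 c0 [auu abuv bcvv] H]]]] := expect_colcomb_cholesky k u v.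
have a1 : a = 1.
  by apply/eqP; rewrite -(eqrXn2 (n := 2))// auu u1 expr1n.
have bE : b = dotv u v by rewrite -abuv a1 mul1r.
have cE : c = Num.sqrt (1 - dotv u v ^+ 2).
  by rewrite -v1 -bcvv bE addrC addKr sqrtr_sqr ger0_norm.
apply: etrans (H _ bf) _; apply: eq_expect => x; apply: eq_expect => y.
rewrite a1 bE cE; congr (f (_, _)); apply: eq_from_tnth => i.
by rewrite tnth_mktuple mul1r mul0r addr0.
Qed.

End linear_images.

(** * Unit vectors, normalization and [Fstar] *)

Section normalization.
Context {R : realType}.
Local Notation mR := (measurableTypeR R).
Local Notation V n := (n.-tuple mR).

Lemma dotvC n (u v : n.-tuple R) : dotv u v = dotv v u.
Proof. by apply: eq_bigr => i _; rewrite mulrC. Qed.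

Lemma dotv_normalize n (x y : n.-tuple R) :
  dotv (normalize x) y = dotv x y / normv x.
Proof.
by rewrite mulr_suml; apply: eq_bigr => i _; rewrite tnth_mktuple mulrAC.
Qed.

Lemma dotv_normalize_le1 n (x : n.-tuple R) :
  dotv (normalize x) (normalize x) <= 1.
Proof.
rewrite dotv_normalize dotvC dotv_normalize -mulrA -invfM -expr2 normv_sqr.
by have [->|x0] := eqVneq (dotv x x) 0; rewrite ?mul0r ?divff// ler01.
Qed.

(** Expand ||u + e v||^2 >= 0 for e = 1 and e = -1. *)
Lemma dotv_unit_bound n (u v : n.-tuple R) :
  dotv u u <= 1 -> dotv v v <= 1 -> -1 <= dotv u v <= 1.
Proof.
move=> u1 v1.
have sq (e : R) : e ^+ 2 = 1 -> 0 <= dotv u u + dotv v v + e * 2 * dotv u v.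
  move=> e1; rewrite mulr_sumr -!big_split; apply: sumr_ge0 => i _ /=.
  have -> : tnth u i * tnth u i + tnth v i * tnth v i +
     e * 2 * (tnth u i * tnth v i) = (tnth u i + e * tnth v i) ^+ 2.
    transitivity (tnth u i * tnth u i + e ^+ 2 * (tnth v i * tnth v i) +
      e * 2 * (tnth u i * tnth v i)); first by rewrite e1 mul1r.
    by ring.
  exact: sqr_ge0.
have sqN1 : (-1 : R) ^+ 2 = 1 by ring.
have := sq 1 (expr1n _ _); have := sq (-1) sqN1.
lra.
Qed.

Lemma normv_eq1 n (u : n.-tuple R) : (normv u = 1) <-> (dotv u u = 1).
Proof.
split; first exact: normv1_dotv.
by rewrite /normv => ->; rewrite sqrtr1.
Qed.

Lemma sqr_tnth_le n (x : n.-tuple R) i : tnth x i ^+ 2 <= dotv x x.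
Proof.
rewrite /dotv (bigD1 i)//= -expr2 lerDl; apply: sumr_ge0 => j _.
by rewrite -expr2 sqr_ge0.
Qed.

(** Unlike [normalize], this gives a unit direction to the zero vector too, namely the first basis
    vector, whence the positive dimension. *)
Lemma polar n (x : n.+1.-tuple R) : exists2 w : n.+1.-tuple R, dotv w w = 1 &
  x = [tuple normv x * tnth w i | i < n.+1].
Proof.
have [x0|x0] := eqVneq (normv x) 0.
  exists [tuple (i == ord0)%:R | i < n.+1].
    rewrite /dotv big_ord_recl !tnth_mktuple eqxx mulr1 big1 ?addr0// => i _.
    by rewrite !tnth_mktuple mul0r.
  apply: eq_from_tnth => i; rewrite tnth_mktuple x0 mul0r; apply/eqP.
  rewrite -sqrf_eq0 eq_le sqr_ge0 andbT.
  by have := sqr_tnth_le x i; rewrite -normv_sqr x0 expr0n.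
exists (normalize x).
  by rewrite dotv_normalize dotvC dotv_normalize -mulrA -invfM -expr2 normv_sqr
     divff// -normv_sqr sqrf_eq0.
by apply: eq_from_tnth => i; rewrite !tnth_mktuple mulrC mulfVK.
Qed.

Lemma measurable_fun_dotv d (T : measurableType d) n (f g : T -> V n) :
  measurable_fun setT f -> measurable_fun setT g ->
  measurable_fun setT (fun x => dotv (f x) (g x)).
Proof.
move=> mf mg; apply: measurable_sum => i; apply: measurable_funM.
- exact: (measurableT_comp (measurable_tnth i) mf).
- exact: (measurableT_comp (measurable_tnth i) mg).
Qed.

Lemma measurable_invsqrt d (T : measurableType d) (f : T -> R) :
  measurable_fun setT f -> (forall x, 0 <= f x) ->
  measurable_fun setT (fun x => (Num.sqrt (f x))^-1).
Proof.
move=> mf f0; under eq_fun do rewrite -powR12_sqrt// -powRN.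
exact: (measurableT_comp (measurable_powR _)).
Qed.

Lemma measurable_normalize n : measurable_fun setT (@normalize R n : V n -> V n).
Proof.
apply/measurable_fun_tnthP => i.
rewrite (_ : _ \o _ = fun x => tnth x i * (normv x)^-1); last first.
  by apply/funext => x /=; rewrite tnth_mktuple.
apply: measurable_funM; first exact: measurable_tnth.
by apply: measurable_invsqrt; [exact: measurable_fun_dotv|exact: dotv_ge0].
Qed.

Definition ndot n (p : V n * V n) : R := dotv (normalize p.1) (normalize p.2).

Lemma ndot_le1 n (p : V n * V n) : `|ndot p| <= 1.
Proof.
by rewrite ler_norml; apply: dotv_unit_bound; exact: dotv_normalize_le1.
Qed.

Lemma measurable_ndot n : measurable_fun setT (@ndot n).
Proof.
by apply: measurable_fun_dotv;
   apply: (measurableT_comp (@measurable_normalize n)).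
Qed.

Lemma bmeas_ndot n : bmeas (@ndot n).
Proof. by split; [exact: measurable_ndot|exists 1; exact: ndot_le1]. Qed.

Lemma bmeas_correlated n (rho : R) (f : V n * V n -> R) : bmeas f ->
  bmeas (fun p : V n * V n =>
    f (p.1, lincomb rho p.1 (Num.sqrt (1 - rho ^+ 2)) p.2)).
Proof.
move=> bf; apply: (bmeas_comp bf); apply: measurable_fun_pair => //.
exact: measurable_lincomb.
Qed.

Lemma lincomb10 n (x y : n.-tuple R) : lincomb 1 x 0 y = x.
Proof.
by apply: eq_from_tnth => i; rewrite tnth_mktuple mul1r mul0r addr0.
Qed.

Lemma FstarE k (rho : R) : Fstar k rho = \E (gauss k) (fun x => \E (gauss k)
  (fun y => ndot (x, lincomb rho x (Num.sqrt (1 - rho ^+ 2)) y))).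
Proof.
have bN := bmeas_correlated rho (bmeas_ndot k).
transitivity (gauss_exp (fun x => \E (gauss k)
  (fun y => ndot (x, lincomb rho x (Num.sqrt (1 - rho ^+ 2)) y)))).
  apply: eq_gauss_exp => x; rewrite -gauss_expE; last exact: (bmeas_section x bN).
  by apply: eq_gauss_exp => y; rewrite lincomb10.
by rewrite gauss_expE//; exact: (bmeas_expect _ bN).
Qed.

Lemma Fstar_le1 k (rho : R) : Fstar k rho <= 1.
Proof.
have bN := bmeas_correlated rho (bmeas_ndot k).
rewrite FstarE (le_trans (ler_norm _))//; apply: norm_expect_le.
  by case: (bmeas_expect (gauss k) bN).
move=> x; apply: norm_expect_le; first by case: (bmeas_section x bN).
by move=> y; exact: ndot_le1.
Qed.

End normalization.

(** * The graph objective, rounding, and the lower bound on the ratio *)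

Section graphs.
Context {R : realType} (V : finType) (G : @wgraph R V).

Definition quad d (f : V -> d.-tuple R) : R :=
  \sum_(u : V) \sum_(v : V) wt G u v * dotv (f u) (f v).

Lemma prod_valE d (f : V -> d.-tuple R) : prod_val G f = 4^-1 - 4^-1 * quad f.
Proof.
transitivity (4^-1 * (\sum_(u : V) \sum_(v : V) wt G u v) - 4^-1 * quad f);
  last by rewrite wt_sum1 mulr1.
rewrite !mulr_sumr -sumrB; apply: eq_bigr => u _.
rewrite !mulr_sumr -sumrB; apply: eq_bigr => v _; ring.
Qed.

Lemma prod_val_le d (f : V -> d.-tuple R) :
  (forall v, dotv (f v) (f v) <= 1) -> 0 <= prod_val G f <= 2^-1.
Proof.
move=> f1; have h u v : -1 <= dotv (f u) (f v) <= 1 by exact: dotv_unit_bound.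
apply/andP; split.
  apply: sumr_ge0 => u _; apply: sumr_ge0 => v _; apply: mulr_ge0.
    exact: wt_ge0.
  by have := h u v; lra.
apply: (@le_trans _ _ (2^-1 * (\sum_(u : V) \sum_(v : V) wt G u v)));
  last by rewrite wt_sum1 mulr1.
rewrite mulr_sumr; apply: ler_sum => u _.
rewrite mulr_sumr; apply: ler_sum => v _; rewrite mulrC ler_wpM2r ?wt_ge0//.
by have := h u v; lra.
Qed.

(** Since v0 carries no loop, its vector enters linearly; symmetry of the weights gives the factor
    2. *)
Lemma quad_split d (f : V -> d.-tuple R) v0 :
  quad f = 2 * dotv (f v0) [tuple \sum_(v | v != v0) wt G v0 v * tnth (f v) i | i < d]
   + \sum_(u | u != v0) \sum_(v | v != v0) wt G u v * dotv (f u) (f v).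
Proof.
have dotS : dotv (f v0) [tuple \sum_(v | v != v0) wt G v0 v * tnth (f v) i | i < d] =
    \sum_(v | v != v0) wt G v0 v * dotv (f v0) (f v).
  rewrite /dotv; under eq_bigr do rewrite tnth_mktuple mulr_sumr.
  rewrite exchange_big; apply: eq_bigr => v _ /=; rewrite mulr_sumr.
  by apply: eq_bigr => i _; ring.
rewrite /quad (bigD1 v0)//= (bigD1 v0)//= wt_noloop mul0r add0r dotS.
under [X in _ + X = _]eq_bigr do rewrite (bigD1 v0)//=.
rewrite big_split /= addrA; congr (_ + _).
rewrite mulr_natl mulr2n; congr (_ + _).
by apply: eq_bigr => v _; rewrite wt_sym dotvC.
Qed.

(* The objective is affine in each vertex vector since there are no loops. *)
Lemma sphere_of_ball d (f : V -> d.+1.-tuple R) :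
  (forall v, dotv (f v) (f v) <= 1) ->
  exists2 f' : V -> d.+1.-tuple R, forall v, normv (f' v) = 1 &
    prod_val G f <= prod_val G f'.
Proof.
move=> f1.
suff H (s : seq V) : exists f' : V -> d.+1.-tuple R,
    [/\ forall v, dotv (f' v) (f' v) <= 1, {in s, forall v, dotv (f' v) (f' v) = 1} &
      prod_val G f <= prod_val G f'].
  have [f' [_ f'1 le]] := H (enum V); exists f' => // v.
  by apply/normv_eq1; rewrite f'1// mem_enum.
elim: s => [|v0 s [g [g1 gs le]]]; first by exists f.
set S := [tuple \sum_(v | v != v0) wt G v0 v * tnth (g v) i | i < d.+1].
have [w w1 wS] : exists2 w : d.+1.-tuple R, dotv w w = 1 &
    dotv w S <= dotv (g v0) S.
  (* With [g v0] = r w0 and 0 <= r <= 1, one of w0 and -w0 has inner product with S at most r <w0,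
     S>. *)
  have [w0 w01 gE] := polar (g v0); set r := normv (g v0) in gE.
  have /andP[r0 r1] : 0 <= r <= 1.
    rewrite sqrtr_ge0 /= -(ler_pXn2r (n := 2))// ?nnegrE ?sqrtr_ge0//.
    by rewrite normv_sqr expr1n.
  have gS : dotv (g v0) S = r * dotv w0 S.
    by rewrite gE mulr_sumr; apply: eq_bigr => i _; rewrite tnth_mktuple mulrA.
  have [t0|t0] := leP (dotv w0 S) 0; first by exists w0; rewrite // gS; nra.
  exists [tuple - tnth w0 i | i < d.+1].
    by rewrite -w01; apply: eq_bigr => i _; rewrite !tnth_mktuple mulrNN.
  have -> : dotv [tuple - tnth w0 i | i < d.+1] S = - dotv w0 S.
    by rewrite -sumrN; apply: eq_bigr => i _; rewrite tnth_mktuple mulNr.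
  by rewrite gS; nra.
exists (fun v => if v == v0 then w else g v); split.
- by move=> v; case: ifP => // _; rewrite w1.
- move=> v; rewrite inE; case: eqVneq => //= _; exact: gs.
apply: (le_trans le); rewrite !prod_valE lerD2l lerN2 ler_wpM2l//.
rewrite !(quad_split _ v0) eqxx; apply: lerD; last first.
  rewrite le_eqVlt; apply/orP; left; apply/eqP.
  by apply: eq_bigr => u /negPf ->; apply: eq_bigr => v /negPf ->.
rewrite ler_wpM2l// (_ : [tuple _ | i < d.+1] = S)//.
by apply: eq_from_tnth => i; rewrite !tnth_mktuple; apply: eq_bigr => v /negPf ->.
Qed.

Lemma wgraph_card_gt0 : (0 < #|V|)%N.
Proof.
rewrite lt0n; apply/negP => /eqP/card0_eq V0.
have := wt_sum1 G; rewrite big_pred0; first by move/esym/eqP; rewrite oner_eq0.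
by move=> u; have := V0 u.
Qed.

Let vals d := [set prod_val G f | f in [set f : V -> d.-tuple R |
                                   forall v, normv (f v) = 1]].

Lemma prod_val_ubound d : ubound (vals d) 2^-1.
Proof.
move=> _ [f /= f1 <-].
have h v : dotv (f v) (f v) <= 1 by rewrite (normv_eq1 _).1.
by have /andP[] := prod_val_le h.
Qed.

Lemma vals_nonempty d : (0 < d)%N -> vals d !=set0.
Proof.
case: d => // d _.
have [|f f1 _] := @sphere_of_ball d (fun=> [tuple 0 | i < d.+1]).
  by move=> v; rewrite /dotv big1 ?ler01// => i _; rewrite tnth_mktuple mul0r.
by exists (prod_val G f), f.
Qed.

Lemma prod_val_le_Prod (f : V -> 3.-tuple R) :
  (forall v, dotv (f v) (f v) <= 1) -> prod_val G f <= Prod G.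
Proof.
move=> /sphere_of_ball[f' f'1 le]; apply: (le_trans le).
by apply: ub_le_sup; [exists 2^-1; exact: prod_val_ubound|exists f'].
Qed.

Lemma prod_val_le_SDP (f : V -> #|V|.-tuple R) :
  (forall v, dotv (f v) (f v) <= 1) -> prod_val G f <= SDP_Prod G.
Proof.
rewrite /SDP_Prod; move: wgraph_card_gt0 f (@prod_val_ubound #|V|).
case: #|V| => // d _ f ub /sphere_of_ball[f' f'1 le]; apply: (le_trans le).
by apply: ub_le_sup; [exists 2^-1; exact: ub|exists f'].
Qed.

(** Giving each vertex its own basis vector has value 1/4, because the weights sit on pairs of
    distinct vertices, whose vectors are orthogonal. *)
Lemma SDP_Prod_gt0 : 0 < SDP_Prod G.
Proof.
pose f (v : V) : #|V|.-tuple R := [tuple (i == enum_rank v)%:R | i < #|V|].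
have fE u v : dotv (f u) (f v) = (u == v)%:R.
  rewrite /dotv (bigD1 (enum_rank u))//= !tnth_mktuple eqxx mul1r big1 ?addr0.
    by rewrite (inj_eq enum_rank_inj).
  by move=> i /negPf iu; rewrite !tnth_mktuple iu mul0r.
apply: (@lt_le_trans _ _ (prod_val G f)).
  rewrite prod_valE /quad big1 ?mulr0 ?subr0// => u _.
  rewrite big1// => v _; rewrite fE; case: eqVneq => [->|]; rewrite ?mulr0//.
  by rewrite wt_noloop mul0r.
by apply: prod_val_le_SDP => v; rewrite fE eqxx.
Qed.

Lemma alpha_BOV_ge0 : 0 <= @alpha_BOV R.
Proof.
apply: lb_le_inf; first by exists ((1 - Fstar 3 0) / (1 - 0)), 0 => //=; lra.
move=> _ [rho /= rho1 <-]; rewrite divr_ge0// subr_ge0; first exact: Fstar_le1.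
by lra.
Qed.

(** The endpoint rho = 1 is outside the infimum but occurs when an edge joins equal vectors; there
    the left side is 0. *)
Lemma alpha_BOV_le (rho : R) : -1 <= rho <= 1 ->
  alpha_BOV * (1 - rho) <= 1 - Fstar 3 rho.
Proof.
move=> /andP[rho0]; rewrite le_eqVlt => /predU1P[->|rho1].
  by rewrite subrr mulr0 subr_ge0 Fstar_le1.
rewrite -ler_pdivlMr ?subr_gt0//; apply: ge_inf; last by exists rho; rewrite //= rho0.
exists 0 => _ [r /= r1 <-]; rewrite divr_ge0// subr_ge0; first exact: Fstar_le1.
by lra.
Qed.

Lemma rounding m (g : V -> m.-tuple R) : (forall v, normv (g v) = 1) ->
  alpha_BOV * prod_val G g <= Prod G.
Proof.
move=> g1.
pose F (Z : m.-tuple (3.-tuple (measurableTypeR R))) (v : V) : 3.-tuple R :=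
  normalize (colcomb (g v) Z).
have bF u v : bmeas (fun Z => dotv (F Z u) (F Z v)).
  apply: (bmeas_comp (bmeas_ndot 3) (g := fun Z => (colcomb (g u) Z, colcomb (g v) Z))).
  by apply: measurable_fun_pair; exact: measurable_colcomb.
have bt u v : bmeas (fun Z => wt G u v * dotv (F Z u) (F Z v)).
  by apply: bmeasM => //; exact: bmeas_cst.
pose P := tuple_prob (gauss 3) m : probability (m.-tuple (3.-tuple (measurableTypeR R))) R.
have bq : bmeas (fun Z => quad (F Z)).
  by apply: bmeas_sum => u; apply: bmeas_sum.
have bp : bmeas (fun Z => 4^-1 - 4^-1 * quad (F Z)).
  by apply: bmeasD; [exact: bmeas_cst|apply: bmeasN; apply: bmeasM => //; exact: bmeas_cst].
have [Z leZ] := exists_ge_expect P bp.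
(* A column combination may be 0 and then stays 0 after normalization, so the rounded vectors are
   compared with [Prod] through the ball. *)
apply: (@le_trans _ _ (prod_val G (F Z))); last first.
  by apply: prod_val_le_Prod => v; exact: dotv_normalize_le1.
rewrite (prod_valE (F Z)); apply: le_trans leZ.
rewrite expectB; [|exact: bmeas_cst|by apply: bmeasM => //; exact: bmeas_cst].
rewrite expect_cst expectZ// expect_sum; last by move=> u; exact: bmeas_sum.
under eq_bigr do rewrite expect_sum//.
have -> : \sum_(u : V) \sum_(v : V) \E P (fun Z => wt G u v * dotv (F Z u) (F Z v)) =
    \sum_(u : V) \sum_(v : V) wt G u v * Fstar 3 (dotv (g u) (g v)).
  apply: eq_bigr => u _; apply: eq_bigr => v _; rewrite expectZ//; congr (_ * _).
  rewrite FstarE; apply: (expect_colcomb (g1 u) (g1 v) (bmeas_ndot 3)).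
apply: (@le_trans _ _ (4^-1 * (\sum_(u : V) \sum_(v : V) wt G u v) -
    4^-1 * \sum_(u : V) \sum_(v : V) wt G u v * Fstar 3 (dotv (g u) (g v))));
  last by rewrite wt_sum1 mulr1.
rewrite !mulr_sumr -sumrB.
apply: ler_sum => u _; rewrite !mulr_sumr -sumrB; apply: ler_sum => v _.
have w0 := wt_ge0 G u v.
have h : -1 <= dotv (g u) (g v) <= 1.
  by apply: dotv_unit_bound; rewrite (normv_eq1 _).1.
have := ler_wpM2l w0 (alpha_BOV_le h); lra.
Qed.

Lemma alpha_SDP_le_Prod : alpha_BOV * SDP_Prod G <= Prod G.
Proof.
(* The bound on the supremum divides by [alpha_BOV], so the value 0 is treated apart. *)
have := alpha_BOV_ge0; rewrite le_eqVlt => /predU1P[<-|a0].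
  rewrite mul0r; apply: le_trans (prod_val_le_Prod (f := fun=> [tuple 0 | i < 3]) _).
    suff /prod_val_le/andP[] : forall v : V,
      dotv ((fun=> [tuple 0 | i < 3]) v : 3.-tuple R) [tuple 0 | i < 3] <= 1 by [].
    by move=> v; rewrite /dotv big1 ?ler01// => i _; rewrite tnth_mktuple mul0r.
  by move=> v; rewrite /dotv big1 ?ler01// => i _; rewrite tnth_mktuple mul0r.
rewrite mulrC -ler_pdivlMr//; apply: ge_sup; first exact: (vals_nonempty wgraph_card_gt0).
by move=> _ [g /= g1 <-]; rewrite ler_pdivlMr// mulrC; exact: rounding.
Qed.

Lemma alpha_BOV_le_ratio : alpha_BOV <= Prod G / SDP_Prod G.
Proof. by rewrite ler_pdivlMr ?SDP_Prod_gt0// alpha_SDP_le_Prod. Qed.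

End graphs.

(** * Dominated convergence and Gaussian moments *)

Section moments.
Context {R : realType}.
Local Notation mR := (measurableTypeR R).

Lemma expect_dominated d (T : measurableType d) (P : probability T R)
    (f_ : nat -> T -> R) (f g : T -> R) :
  (forall n, measurable_fun [set: T] (f_ n)) -> measurable_fun [set: T] f ->
  P.-integrable [set: T] (EFin \o g) ->
  (forall n x, `|f_ n x| <= g x) -> (forall x, f_ n x @[n --> \oo] --> f x) ->
  \E P (f_ n) @[n --> \oo] --> \E P f.
Proof.
move=> mf_ mf ig fg ff.
have [] := @dominated_convergence _ T R P setT measurableT
    (fun n => EFin \o f_ n) (EFin \o f) (EFin \o g).
- by move=> n; exact/measurable_EFinP.
- exact/measurable_EFinP.
- by apply: aeW => x _; apply: cvg_EFin; [exact: nearW|exact: ff].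
- exact: ig.
- by apply: aeW => x n _; rewrite lee_fin fg.
move=> fi _ cv; apply: fine_cvg; rewrite fineK//.
exact: integrable_fin_num fi.
Qed.

Local Open Scope ereal_scope.

Lemma ge0_integral_tnth d (T : measurableType d) (P : probability T R) n
    (j : 'I_n) (f : T -> \bar R) :
  measurable_fun [set: T] f -> (forall x, 0 <= f x) ->
  \int[tuple_prob P n]_x f (tnth x j) = \int[P]_t f t.
Proof.
move=> mf f0; elim: n j => [[]//|n IH] j.
transitivity (\int[(P \x tuple_prob P n)]_p f (tnth (cons_pair p) j)).
  apply: (ge0_integral_distribution (@cons_pair _ T n)
    (f := fun x : n.+1.-tuple T => f (tnth x j))) => //.
  exact: (measurableT_comp mf (measurable_tnth j)).
rewrite (fubini_tonelli1 (fun p => f (tnth (cons_pair p) j)))//; last first.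
  apply: (measurableT_comp mf).
  exact: (measurableT_comp (measurable_tnth j) (@measurable_cons_pair _ T n)).
rewrite /fubini_F; case: (unliftP ord0 j) => [i ->|->].
  transitivity (\int[P]_t cst (\int[P]_u f u) t).
    apply: eq_integral => t _; rewrite -(IH i); apply: eq_integral => x _.
    by rewrite /cons_pair tnthS.
  by rewrite integral_cst// -[X in _ * X]/(P setT) probability_setT mule1.
apply: eq_integral => t _; transitivity (\int[tuple_prob P n]_x cst (f t) x).
  by apply: eq_integral => x _; rewrite /cons_pair tnth0.
by rewrite integral_cst// -[X in _ * X]/(tuple_prob P n setT) probability_setT mule1.
Qed.

(* x^2 exp(-x^2/2) <= (8/3) exp(-x^2/8), because y <= exp y at y = 3x^2/8. *)
Lemma integrable_sqr_gauss1 :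
  gauss1.-integrable [set: mR] (fun x : mR => (x ^+ 2)%:E).
Proof.
have m2 : measurable_fun [set: mR] (fun x : mR => x ^+ 2)%R by exact: measurable_funX.
apply/integrableP; split; first exact/measurable_EFinP.
under eq_integral do rewrite gee0_abs ?lee_fin ?sqr_ge0//.
rewrite ge0_integral_normal_prob//; first last.
- by move=> x; rewrite lee_fin sqr_ge0.
- exact/measurable_EFinP.
have mp (s : R) : measurable_fun [set: mR] (fun x : mR => normal_pdf 0 s x).
  exact: measurable_normal_pdf.
pose C : R := (8 / 3 * (normal_peak 1 / normal_peak 2))%R.
have C0 : (0 <= C)%R by rewrite mulr_ge0// divr_ge0// normal_peak_ge0.
apply: (@le_lt_trans _ _ (\int[@lebesgue_measure R]_x (C%:E * (normal_pdf 0 2 x)%:E))).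
  apply: ge0_le_integral => //.
  - by move=> x _; rewrite -EFinM lee_fin mulr_ge0 ?sqr_ge0 ?normal_pdf_ge0.
  - by apply: emeasurable_funM; apply/measurable_EFinP.
  - by apply: emeasurable_funM; apply/measurable_EFinP => //; exact: measurable_cst.
  move=> x _; rewrite -!EFinM lee_fin !normal_pdfE ?oner_eq0 ?pnatr_eq0//.
  have p2 : normal_peak 2 != 0%R :> R by rewrite gt_eqF// normal_peak_gt0// pnatr_eq0.
  have -> : (C * (normal_peak 2 * normal_fun 0 2 x) =
      normal_peak 1 * (8 / 3 * normal_fun 0 2 x))%R by rewrite /C; field.
  rewrite mulrCA ler_wpM2l ?normal_peak_ge0// /normal_fun subr0.
  have -> : (- x ^+ 2 / (1 ^+ 2 *+ 2) = - x ^+ 2 / (2 ^+ 2 *+ 2) - 3 / 8 * x ^+ 2)%R.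
    by field.
  rewrite expRD expRN [leLHS]mulrCA mulrC ler_wpM2r ?expR_ge0//.
  rewrite ler_pdivrMr ?expR_gt0//.
  have := expR_ge1Dx (3 / 8 * x ^+ 2)%R; lra.
rewrite ge0_integralZl//; first last.
- by move=> x _; rewrite lee_fin normal_pdf_ge0.
- exact/measurable_EFinP.
by rewrite integral_normal_pdf mule1 ltry.
Qed.

(** Reduces to the second moment through |t| <= 1 + t^2. *)
Lemma integrable_abs_gauss n (j : 'I_n) :
  (gauss n).-integrable [set: n.-tuple mR] (fun x => `|tnth x j|%:E).
Proof.
have mn : measurable_fun [set: mR] (fun t : mR => `|t|%:E : \bar R).
  by apply/measurable_EFinP; exact: (measurableT_comp (@normr_measurable R setT)).
apply/integrableP; split.
  exact: (measurableT_comp mn (measurable_tnth j)).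
under eq_integral do rewrite gee0_abs ?lee_fin ?normr_ge0//.
rewrite (ge0_integral_tnth gauss1 j (f := fun t : mR => `|t|%:E))//.
have /integrableP[m2 fin2] := integrable_sqr_gauss1.
apply: (@le_lt_trans _ _ (\int[gauss1]_t (1 + (t ^+ 2)%:E))).
  apply: ge0_le_integral => //.
  - by apply: emeasurable_funD.
  - move=> t _; rewrite -EFinD lee_fin.
    by rewrite -(real_normK (num_real t)); have := sqr_ge0 (`|t| - 1)%R; nra.
rewrite ge0_integralD//; last by move=> t _; rewrite lee_fin sqr_ge0.
rewrite integral_cst// mul1e -[X in X + _]/(gauss1 setT) probability_setT.
apply: lte_add_pinfty; first exact: ltry.
rewrite (eq_integral (fun t : mR => `|(t ^+ 2)%:E|)) ?fin2//.
by move=> t _; rewrite gee0_abs// lee_fin sqr_ge0.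
Qed.

End moments.

(** * Noise stability of odd Lipschitz functions *)

Section gebelein.
Context {R : realType}.
Local Notation mR := (measurableTypeR R).
Local Notation V n := (n.-tuple mR).

Lemma expect_cauchy_schwarz d (T : measurableType d) (P : probability T R)
    (f g : T -> R) : bmeas f -> bmeas g ->
  (\E P (fun x => f x * g x)) ^+ 2 <=
  \E P (fun x => f x * f x) * \E P (fun x => g x * g x).
Proof.
move=> bf bg; set B := \E P _; set A := \E P _; set C := \E P _.
have ff := bmeasM bf bf; have fg := bmeasM bf bg; have gg := bmeasM bg bg.
have pos t : 0 <= A - 2 * t * B + t ^+ 2 * C.
  have bc c h : bmeas h -> bmeas (fun x : T => c * h x).
    by move=> bh; apply: bmeasM => //; exact: bmeas_cst.
  rewrite -!expectZ// -expectB//; last exact: bc.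
  rewrite -expectD; [|by apply: bmeasD => //; apply: bmeasN; exact: bc|exact: bc].
  apply: Rintegral_ge0 => x _.
  have -> : f x * f x - 2 * t * (f x * g x) + t ^+ 2 * (g x * g x) =
    (f x - t * g x) ^+ 2 by ring.
  exact: sqr_ge0.
have C0 : 0 <= C by apply: Rintegral_ge0 => x _; rewrite -expr2 sqr_ge0.
have [C00|Cn0] := eqVneq C 0.
  rewrite C00 mulr0 le_eqVlt sqrf_eq0; apply/orP; left.
  (* With C = 0 the quadratic is affine in t; this t makes its value -1. *)
  apply: contraT => B0; have := pos ((A + 1) / (2 * B)).
  have -> : A - 2 * ((A + 1) / (2 * B)) * B + ((A + 1) / (2 * B)) ^+ 2 * C = -1.
    by rewrite C00; field.
  by lra.
have Cgt0 : 0 < C by rewrite lt_neqAle eq_sym Cn0.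
have := pos (B / C).
have -> : A - 2 * (B / C) * B + (B / C) ^+ 2 * C = (A * C - B ^+ 2) / C by field.
by rewrite pmulr_lge0 ?invr_gt0// subr_ge0.
Qed.

Variable k : nat.
Implicit Types (h : V k -> R) (rho : R).

Definition corr rho (x y : V k) : V k := lincomb rho x (Num.sqrt (1 - rho ^+ 2)) y.

Definition stab rho h : R :=
  \E (gauss k) (fun x => \E (gauss k) (fun y => h x * h (corr rho x y))).

Lemma bmeas_corr rho h : bmeas h -> bmeas (fun p : V k * V k => h (corr rho p.1 p.2)).
Proof. by move=> bh; apply: (bmeas_comp bh); exact: measurable_lincomb. Qed.

Lemma bmeas_stab rho h : bmeas h ->
  bmeas (fun p : V k * V k => h p.1 * h (corr rho p.1 p.2)).
Proof.
move=> bh; apply: bmeasM; last exact: bmeas_corr.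
by apply: (bmeas_comp bh).
Qed.

(** With T the noise operator at rho, the stability is E[h T h], and Cauchy-Schwarz leaves
    E[(T h)^2]. Writing this square with two independent noises gives two vectors correlated through
    x only, of correlation rho^2. *)
Lemma stab_sqr_le rho h : 0 <= rho <= 1 -> bmeas h ->
  stab rho h ^+ 2 <= \E (gauss k) (fun x => h x * h x) * stab (rho ^+ 2) h.
Proof.
move=> /andP[rho0 rho1] bh; have bc := bmeas_corr rho bh.
pose T x := \E (gauss k) (fun y => h (corr rho x y)).
have bT : bmeas T := bmeas_expect (gauss k) bc.
have -> : stab rho h = \E (gauss k) (fun x => h x * T x).
  by apply: eq_expect => x; rewrite expectZ//; exact: (bmeas_section x bc).
apply: (le_trans (expect_cauchy_schwarz _ bh bT)).
rewrite le_eqVlt; apply/orP; left; apply/eqP; congr (_ * _).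
pose s := Num.sqrt (1 - rho ^+ 2).
have s2 : rho ^+ 2 + s ^+ 2 = 1.
  by rewrite sqr_sqrtr ?subrKC// subr_ge0 expr_le1.
(* Coefficients of the two noisy copies on the columns (x, y, z): unit vectors with inner product
   rho^2. *)
pose u : 3.-tuple R := [tuple rho; s; 0]; pose v : 3.-tuple R := [tuple rho; 0; s].
have u1 : normv u = 1.
  apply/normv_eq1; rewrite /dotv !big_ord_recl big_ord0 !(tnth_nth 0) /= -s2; ring.
have v1 : normv v = 1.
  apply/normv_eq1; rewrite /dotv !big_ord_recl big_ord0 !(tnth_nth 0) /= -s2; ring.
have uv : dotv u v = rho ^+ 2.
  by rewrite /dotv !big_ord_recl big_ord0 !(tnth_nth 0) /=; ring.
pose f (p : V k * V k) := h p.1 * h p.2.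
have bf : bmeas f by apply: bmeasM; apply: (bmeas_comp bh).
have := expect_colcomb u1 v1 bf; rewrite uv => H.
apply: etrans H; rewrite expect_tuple_probS; last first.
  apply: (bmeas_comp bf); apply: measurable_fun_pair; exact: measurable_colcomb.
apply: eq_expect => x.
have bf1 : bmeas (fun Z : 2.-tuple (V k) =>
    f (lincomb rho x 1 (colcomb [tuple s; 0] Z), lincomb rho x 1 (colcomb [tuple 0; s] Z))).
  apply: (bmeas_comp bf); apply: measurable_fun_pair;
    apply: measurable_lincomb => //; exact: measurable_colcomb.
transitivity (\E (tuple_prob (gauss k) 2) (fun Z =>
    f (lincomb rho x 1 (colcomb [tuple s; 0] Z),
       lincomb rho x 1 (colcomb [tuple 0; s] Z)))); last first.
  apply: eq_expect => Z; rewrite -!colcomb_cons.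
  by congr (f (colcomb _ _, colcomb _ _)); apply: val_inj.
have -> : T x * T x = \E (gauss k) (fun y => \E (gauss k) (fun z =>
    h (corr rho x y) * h (corr rho x z))).
  rewrite -expectZ; last exact: (bmeas_section x bc).
  apply: eq_expect => y; rewrite mulrC -expectZ//; exact: (bmeas_section x bc).
rewrite expect_tuple_probS//; apply: eq_expect => y.
have bf2 := bmeas_section y (bmeas_cons bf1).
rewrite expect_tuple_probS//; apply: eq_expect => z.
rewrite expect_tuple_prob0; last exact: (bmeas_section z (bmeas_cons bf2)).
congr (h _ * h _); apply: eq_from_tnth => i; rewrite !tnth_mktuple;
  rewrite !big_ord_recl big_ord0 !(tnth_nth 0) /= ?(tnth_nth y) /= -/s; ring.
Qed.

Definition norm1 (x : V k) : R := \sum_(i < k) `|tnth x i|.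

Lemma integrable_norm1 : (gauss k).-integrable [set: V k] (EFin \o norm1).
Proof.
rewrite (_ : EFin \o norm1 = fun x => (\sum_(i < k) `|tnth x i|%:E)%E).
  by apply: integrable_sum => // i _; exact: integrable_abs_gauss.
by apply/funext => x /=; rewrite sumEFin.
Qed.

(** Symmetry of the Gaussian law is its invariance under the rotation by pi; [lincomb (-1) x 0 x] is
    -x. *)
Lemma expect_odd h : bmeas h ->
  (forall x, h (lincomb (-1) x 0 x) = - h x) -> \E (gauss k) h = 0.
Proof.
move=> bh hodd.
have cs : (-1 : R) ^+ 2 + 0 ^+ 2 = 1 by ring.
have b1 : bmeas (fun p : V k * V k => h p.1) by apply: (bmeas_comp bh).
have := expect_gauss_rotation cs b1 => /=.
under eq_expect do under eq_expect do rewrite oppr0.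
have -> : \E (gauss k) (fun x => \E (gauss k) (fun=> h x)) = \E (gauss k) h.
  by apply: eq_expect => x; rewrite expect_cst.
have -> : \E (gauss k) (fun x => \E (gauss k) (fun y => h (lincomb (-1) x 0 y))) =
    - \E (gauss k) h.
  rewrite -[RHS]mulN1r -expectZ//; apply: eq_expect => x.
  rewrite -[RHS](expect_cst (gauss k)); apply: eq_expect => y.
  rewrite mulN1r -hodd; congr h; apply: eq_from_tnth => i.
  by rewrite !tnth_mktuple !mul0r.
by move=> E0; lra.
Qed.

(** Replacing h(rho x + s y) by h(s y) costs at most |L| rho times the l1 norm of x, which has
    finite mean. What remains factors, and vanishes because h has mean 0. *)
Lemma stab_linear_bound h (L M : R) : measurable_fun setT h ->
  (forall x, `|h x| <= M) -> (forall x, h (lincomb (-1) x 0 x) = - h x) ->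
  (forall x y, `|h x - h y| <= L * \sum_(i < k) `|tnth x i - tnth y i|) ->
  exists2 C, 0 <= C & forall rho, 0 <= rho <= 1 -> stab rho h <= C * rho.
Proof.
move=> mh hM hodd hL; have bh : bmeas h by split => //; exists M.
have n1ge0 x : 0 <= norm1 x by apply: sumr_ge0 => i _.
have M0 : 0 <= M by apply: le_trans (hM [tuple 0 | i < k]).
exists (M * `|L| * \E (gauss k) norm1).
  apply: mulr_ge0; first exact: mulr_ge0.
  by apply: Rintegral_ge0 => x _; exact: n1ge0.
move=> rho /andP[rho0 rho1].
pose s := Num.sqrt (1 - rho ^+ 2).
pose sc (y : V k) : V k := lincomb 0 y s y.
have bs : bmeas (fun y => h (sc y)) by apply: (bmeas_comp bh); exact: measurable_lincomb.
have bst := bmeas_stab rho bh; have bc := bmeas_corr rho bh.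
have bd x : bmeas (fun y => h (corr rho x y) - h (sc y)).
  by apply: bmeasD; [exact: (bmeas_section x bc)|exact: bmeasN].
have step x : \E (gauss k) (fun y => h x * h (corr rho x y)) <=
    h x * \E (gauss k) (fun y => h (sc y)) + M * (`|L| * (rho * norm1 x)).
  rewrite expectZ; last exact: (bmeas_section x bc).
  rewrite -lerBlDl -mulrBr -expectB//; last exact: (bmeas_section x bc).
  rewrite (le_trans (ler_norm _))// normrM ler_pM//.
  apply: norm_expect_le; first by case: (bd x).
  move=> y; apply: (le_trans (hL _ _)).
  have -> : \sum_(i < k) `|tnth (corr rho x y) i - tnth (sc y) i| = rho * norm1 x.
    rewrite mulr_sumr; apply: eq_bigr => i _; rewrite !tnth_mktuple -/s.
    by rewrite mul0r add0r addrK normrM ger0_norm.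
  by rewrite ler_wpM2r ?ler_norm// mulr_ge0.
pose F1 x := h x * \E (gauss k) (fun y => h (sc y)).
pose F2 x := M * `|L| * rho * norm1 x.
have i1 : (gauss k).-integrable setT (EFin \o F1).
  by apply: bmeas_integrable; apply: bmeasM => //; exact: bmeas_cst.
have i2 : (gauss k).-integrable setT (EFin \o F2).
  rewrite (_ : EFin \o F2 = (fun x => (M * `|L| * rho)%:E * (EFin \o norm1) x)%E).
    by apply: integrableZl => //; exact: integrable_norm1.
  by apply/funext => x /=; rewrite EFinM.
apply: (@le_trans _ _ (\E (gauss k) (fun x => F1 x + F2 x))).
  apply: le_Rintegral => //.
  - exact: (bmeas_integrable _ (bmeas_expect (gauss k) bst)).
  - rewrite (_ : EFin \o _ = ((EFin \o F1) \+ (EFin \o F2))%E)//.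
    exact: integrableD.
  - by move=> x _; rewrite /F2 -!mulrA; exact: step.
rewrite RintegralD// /F1 /F2.
rewrite RintegralZl//; last exact: integrable_norm1.
under eq_expect do rewrite mulrC.
rewrite expectZ// (expect_odd bh hodd) mulr0 add0r.
by rewrite le_eqVlt; apply/orP; left; apply/eqP; ring.
Qed.

(** By Bernoulli's inequality, powers of a number above 1 are unbounded along the exponents 2^j. *)
Lemma exp_bounded_le1 (q C : R) : 0 <= q -> (forall j, q ^+ (2 ^ j) <= C) -> q <= 1.
Proof.
move=> q0 H; rewrite leNgt; apply/negP => q1.
have bern n : 1 + n%:R * (q - 1) <= q ^+ n.
  elim: n => [|n IH]; first by rewrite mul0r addr0 expr0.
  rewrite exprS -natr1; apply: (@le_trans _ _ (q * (1 + n%:R * (q - 1)))).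
    rewrite -subr_ge0; have -> : q * (1 + n%:R * (q - 1)) -
        (1 + (n%:R + 1) * (q - 1)) = n%:R * (q - 1) ^+ 2 by ring.
    by rewrite mulr_ge0// sqr_ge0.
  by rewrite ler_wpM2l.
have C0 : 0 <= C / (q - 1).
  by rewrite divr_ge0 ?subr_ge0 ?(ltW q1)// (le_trans _ (H 0))// exprn_ge0.
have := archi_boundP C0; set n := Num.bound _ => Cn.
have : C < n%:R * (q - 1) by rewrite -ltr_pdivrMr// subr_gt0.
have nj : (n%:R : R) <= (2 ^ n)%:R by rewrite ler_nat ltnW// ltn_expl.
have := le_trans (bern _) (H n).
have : n%:R * (q - 1) <= (2 ^ n)%:R * (q - 1) by rewrite ler_wpM2r// subr_ge0 ltW.
lra.
Qed.

(* Tensor power trick: (S(rho) / E)^N <= S(rho^N) / E <= (C / E) rho^N for N = 2^j,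
   and N tends to infinity. *)
Lemma tensor_power (S : R -> R) (E C rho : R) : 0 <= E -> 0 <= C ->
  (forall r, 0 <= r <= 1 -> S r ^+ 2 <= E * S (r ^+ 2)) ->
  (forall r, 0 <= r <= 1 -> S r <= C * r) ->
  0 <= rho <= 1 -> S rho <= rho * E.
Proof.
move=> E0 C0 SS SC rho01; have [s0|s0] := leP (S rho) 0.
  by rewrite (le_trans s0)// mulr_ge0//; case/andP: rho01.
have Egt0 : 0 < E.
  rewrite lt_neqAle E0 andbT eq_sym; apply/negP => /eqP e00.
  by have := SS _ rho01; rewrite e00 mul0r leNgt exprn_gt0.
have rgt0 : 0 < rho.
  rewrite lt_neqAle (andP rho01).1 andbT eq_sym; apply/negP => /eqP r0.
  by have := SC _ rho01; rewrite {2}r0 mulr0 leNgt s0.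
have powle j : (S rho / E) ^+ (2 ^ j) <= S (rho ^+ (2 ^ j)) / E.
  elim: j => [|j IH]; first by rewrite expn0 !expr1.
  rewrite expnS mulnC !exprM; move: (2 ^ j)%N IH => N IH.
  have sig01 : 0 <= rho ^+ N <= 1.
    by case/andP: rho01 => r0 r1; rewrite exprn_ge0//= exprn_ile1.
  have X0 : 0 <= (S rho / E) ^+ N by rewrite exprn_ge0// divr_ge0// ltW.
  apply: (@le_trans _ _ ((S (rho ^+ N) / E) ^+ 2)).
    by apply: lerXn2r => //; rewrite nnegrE//; exact: le_trans IH.
  rewrite expr_div_n ler_pdivrMr ?exprn_gt0//.
  have -> : S ((rho ^+ N) ^+ 2) / E * E ^+ 2 = E * S ((rho ^+ N) ^+ 2).
    by field; rewrite gt_eqF.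
  exact: SS.
rewrite -ler_pdivrMr// -[leRHS]mulr1 -ler_pdivrMl// mulrC.
apply: (@exp_bounded_le1 _ (C / E)).
  by rewrite !divr_ge0// ltW.
move=> j; rewrite expr_div_n ler_pdivrMr ?exprn_gt0//.
apply: (le_trans (powle j)).
rewrite mulrAC ler_pM2r ?invr_gt0//; apply: SC.
by case/andP: rho01 => r0 r1; rewrite exprn_ge0//= exprn_ile1.
Qed.

(** A case of Gebelein's inequality on maximal correlation. L and M are absent from the conclusion,
    so it passes to limits of Lipschitz functions. *)
Lemma gebelein h (L M : R) rho : measurable_fun setT h ->
  (forall x, `|h x| <= M) -> (forall x, h (lincomb (-1) x 0 x) = - h x) ->
  (forall x y, `|h x - h y| <= L * \sum_(i < k) `|tnth x i - tnth y i|) ->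
  0 <= rho <= 1 -> stab rho h <= rho * \E (gauss k) (fun x => h x * h x).
Proof.
move=> mh hM hodd hL; have bh : bmeas h by split => //; exists M.
have [C C0 HC] := stab_linear_bound mh hM hodd hL.
have e0 : 0 <= \E (gauss k) (fun x => h x * h x).
  by apply: Rintegral_ge0 => x _; rewrite -expr2 sqr_ge0.
apply: (tensor_power (S := stab^~ h) e0 C0 _ HC).
by move=> r r01; exact: stab_sqr_le.
Qed.

End gebelein.

(** * Smoothing of x / ||x|| and the bound on [Fstar] for nonnegative correlation *)

Section Fstar_le.
Context {R : realType} (k : nat).
Local Notation mR := (measurableTypeR R).
Local Notation V n := (n.-tuple mR).

(* Lipschitz for del > 0, and equal to the coordinate of normalize x at del = 0. *)
Definition soft (del : R) (i : 'I_k) (x : V k) : R :=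
  tnth x i * (Num.sqrt (dotv x x + del))^-1.

Lemma soft0 i (x : V k) : soft 0 i x = tnth (normalize x) i.
Proof. by rewrite /soft addr0 tnth_mktuple. Qed.

Lemma measurable_soft del i : 0 <= del -> measurable_fun setT (soft del i).
Proof.
move=> d0; apply: measurable_funM; first exact: measurable_tnth.
apply: measurable_invsqrt; last by move=> x; rewrite addr_ge0// dotv_ge0.
by apply: measurable_funD => //; exact: measurable_fun_dotv.
Qed.

Lemma tnth_le_sqrt del (x : V k) i : 0 <= del ->
  `|tnth x i| <= Num.sqrt (dotv x x + del).
Proof.
move=> d0; rewrite -sqrtr_sqr ler_wsqrtr// (le_trans (sqr_tnth_le x i))//.
by rewrite lerDl.
Qed.

Lemma soft_le1 del i x : 0 <= del -> `|soft del i x| <= 1.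
Proof.
move=> d0; have := tnth_le_sqrt x i d0; set A := Num.sqrt _ => xA.
rewrite /soft -/A normrM normfV (ger0_norm (sqrtr_ge0 _)) -/A.
have [A0|A0] := eqVneq A 0; first by rewrite A0 invr0 mulr0 ler01.
by rewrite ler_pdivrMr ?mul1r// lt_neqAle eq_sym A0 sqrtr_ge0.
Qed.

Lemma bmeas_soft del i : 0 <= del -> bmeas (soft del i).
Proof.
move=> d0; split; first exact: measurable_soft.
by exists 1 => x; exact: soft_le1.
Qed.

Lemma soft_odd del i (x : V k) : soft del i (lincomb (-1) x 0 x) = - soft del i x.
Proof.
have t j : tnth (lincomb (-1) x 0 x) j = - tnth x j.
  by rewrite tnth_mktuple mul0r addr0 mulN1r.
rewrite /soft t mulNr; congr (- (_ * (Num.sqrt (_ + _))^-1)).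
by apply: eq_bigr => j _; rewrite !t mulrNN.
Qed.

(** Write A and B for the two denominators, both at least sqrt(del). The difference is (x_i - y_i)/A
    + (y_i/B)(B - A)/A, and |B - A| is bounded by the l1 distance D because |B^2 - A^2| <= D (A +
    B). Each summand contributes D / sqrt(del). *)
Lemma soft_lipschitz del i (x y : V k) : 0 < del ->
  `|soft del i x - soft del i y| <=
  2 / Num.sqrt del * \sum_(j < k) `|tnth x j - tnth y j|.
Proof.
move=> d0; have dge0 := ltW d0.
set A := Num.sqrt (dotv x x + del); set B := Num.sqrt (dotv y y + del).
set D := \sum_(j < k) _; set d := Num.sqrt del.
have dgt0 : 0 < d by rewrite sqrtr_gt0.
have dA : d <= A by rewrite ler_wsqrtr// lerDr dotv_ge0.
have dB : d <= B by rewrite ler_wsqrtr// lerDr dotv_ge0.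
have A0 : 0 < A := lt_le_trans dgt0 dA; have B0 : 0 < B := lt_le_trans dgt0 dB.
have D0 : 0 <= D by apply: sumr_ge0.
have xyD : `|tnth x i - tnth y i| <= D.
  by rewrite /D (bigD1 i)//= lerDl; apply: sumr_ge0.
have AB : `|B - A| <= D.
  have : `|B - A| * (A + B) <= D * (A + B).
    rewrite -{1}(ger0_norm (ltW (addr_gt0 A0 B0))) -normrM.
    have -> : (B - A) * (A + B) = B ^+ 2 - A ^+ 2 by ring.
    rewrite !sqr_sqrtr ?addr_ge0 ?dotv_ge0// opprD addrACA subrr addr0.
    rewrite /dotv -sumrB (le_trans (ler_norm_sum _ _ _))// mulr_suml ler_sum// => j _.
    have -> : tnth y j * tnth y j - tnth x j * tnth x j =
      (tnth y j - tnth x j) * (tnth x j + tnth y j) by ring.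
    rewrite normrM distrC ler_wpM2l// (le_trans (ler_normD _ _))//.
    by apply: lerD; exact: tnth_le_sqrt.
  by rewrite ler_pM2r// addr_gt0.
have -> : soft del i x - soft del i y =
    (tnth x i - tnth y i) / A + tnth y i / B * ((B - A) / A).
  by rewrite /soft -/A -/B; field; rewrite !gt_eqF.
have yB : `|tnth y i / B| <= 1 by exact: soft_le1.
have iA : A^-1 <= d^-1 by rewrite lef_pV2.
have iA0 : 0 <= A^-1 by rewrite invr_ge0 ltW.
apply: (le_trans (ler_normD _ _)).
have h1 : `|(tnth x i - tnth y i) / A| <= D * d^-1.
  by rewrite normrM (ger0_norm iA0) ler_pM.
have h2 : `|tnth y i / B * ((B - A) / A)| <= D * d^-1.
  rewrite normrM -[leRHS]mul1r ler_pM// normrM (ger0_norm iA0) ler_pM//.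
have -> : 2 / d * D = D * d^-1 + D * d^-1 by ring.
exact: lerD.
Qed.

(** At x = 0 the numerator vanishes, so the singular denominator of the limit does no harm. *)
Lemma soft_cvg i x : soft n.+1%:R^-1 i x @[n --> \oo] --> soft 0 i x.
Proof.
have [x0|x0] := eqVneq (dotv x x) 0.
  have t0 : tnth x i = 0.
    apply/eqP; rewrite -sqrf_eq0 eq_le sqr_ge0 andbT -x0; exact: sqr_tnth_le.
  by rewrite /soft t0; under eq_fun do rewrite mul0r; rewrite mul0r; exact: cvg_cst.
apply: cvgM; first exact: cvg_cst.
have cs : Num.sqrt (dotv x x + n.+1%:R^-1) @[n --> \oo] -->
    Num.sqrt (dotv x x + 0).
  have c1 : dotv x x + n.+1%:R^-1 @[n --> \oo] --> dotv x x + 0.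
    by apply: cvgD; [exact: cvg_cst|exact: cvg_harmonic].
  exact: (cvg_comp _ _ c1 (@sqrt_continuous R _)).
have n0 : Num.sqrt (dotv x x + 0) != 0.
  by rewrite addr0 sqrtr_eq0 -ltNge lt_neqAle eq_sym x0 dotv_ge0.
exact: (cvgV n0 cs).
Qed.

Lemma soft_sqr_le del i x : 0 <= del ->
  soft del i x * soft del i x <= soft 0 i x * soft 0 i x.
Proof.
move=> d0; have sE e : 0 <= e -> soft e i x * soft e i x =
    tnth x i ^+ 2 / (dotv x x + e).
  move=> e0; rewrite /soft mulrACA -expr2 -invfM -expr2 sqr_sqrtr//.
  by rewrite addr_ge0// dotv_ge0.
rewrite !sE// addr0; have [x0|x0] := eqVneq (dotv x x) 0.
  have -> : tnth x i ^+ 2 = 0.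
    by apply/eqP; rewrite eq_le sqr_ge0 andbT -x0; exact: sqr_tnth_le.
  by rewrite !mul0r.
have xgt0 : 0 < dotv x x by rewrite lt_neqAle eq_sym x0 dotv_ge0.
by rewrite ler_wpM2l ?sqr_ge0// lef_pV2 ?posrE ?lerDl// ltr_pwDl.
Qed.

(** Smooth with parameter 1/(n+1): the left side converges by dominated convergence, with bound 1,
    while the right side is at most its unsmoothed value for every n. *)
Lemma stab_normalize_le rho i : 0 <= rho <= 1 ->
  stab rho (soft 0 i) <= rho * \E (gauss k) (fun x => soft 0 i x * soft 0 i x).
Proof.
move=> rho01; pose d n : R := n.+1%:R^-1.
have d0 n : 0 <= d n by rewrite invr_ge0.
have bf n := bmeas_stab rho (bmeas_soft i (d0 n)).
have bf0 := bmeas_stab rho (bmeas_soft i (lexx 0)).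
have stabE del : 0 <= del -> stab rho (soft del i) = \E (gauss k \x gauss k)%E
    (fun p => soft del i p.1 * soft del i (corr rho p.1 p.2)).
  by move=> del0; rewrite expect_prod//; exact: (bmeas_stab rho (bmeas_soft i del0)).
have cv : stab rho (soft (d n) i) @[n --> \oo] --> stab rho (soft 0 i).
  rewrite stabE//; under eq_fun do rewrite stabE//.
  apply: (expect_dominated (g := fun=> 1)).
  - by move=> n; case: (bf n).
  - by case: bf0.
  - exact: (bmeas_integrable _ (bmeas_cst _ 1)).
  - by move=> n x; rewrite normrM mulr_ile1// soft_le1.
  - by move=> p; apply: cvgM; exact: soft_cvg.
apply: (cvgr_to_le cv); apply: nearW => n.
have dgt0 : 0 < d n by rewrite invr_gt0.
apply: (@le_trans _ _ (rho * \E (gauss k) (fun x => soft (d n) i x * soft (d n) i x))).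
  apply: (gebelein (L := 2 / Num.sqrt (d n)) (M := 1)) => //.
  - exact: measurable_soft.
  - by move=> x; exact: soft_le1.
  - by move=> x; exact: soft_odd.
  - by move=> x y; exact: soft_lipschitz.
rewrite ler_wpM2l//; first by case/andP: rho01.
apply: le_expect; try by apply: bmeasM; exact: bmeas_soft.
by move=> x; exact: soft_sqr_le.
Qed.

Lemma Fstar_stab (rho : R) : Fstar k rho = \sum_(i < k) stab rho (soft 0 i).
Proof.
rewrite FstarE /stab -expect_sum; last first.
  by move=> i; exact: (bmeas_expect _ (bmeas_stab rho (bmeas_soft i (lexx 0)))).
apply: eq_expect => x; rewrite -expect_sum; last first.
  by move=> i; exact: (bmeas_section x (bmeas_stab rho (bmeas_soft i (lexx 0)))).
by apply: eq_expect => y; apply: eq_bigr => i _; rewrite !soft0.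
Qed.

Lemma Fstar_le_id (rho : R) : 0 <= rho <= 1 -> Fstar k rho <= rho.
Proof.
move=> rho01; rewrite Fstar_stab.
apply: (@le_trans _ _ (\sum_(i < k) rho *
    \E (gauss k) (fun x => soft 0 i x * soft 0 i x))).
  by apply: ler_sum => i _; exact: stab_normalize_le.
have bs i : bmeas (fun x : V k => soft 0 i x * soft 0 i x).
  by apply: bmeasM; exact: bmeas_soft.
rewrite -mulr_sumr -expect_sum// -[leRHS]mulr1 ler_wpM2l//.
  by case/andP: rho01.
rewrite -(expect_cst (gauss k) 1); apply: le_expect.
- exact: bmeas_sum.
- exact: bmeas_cst.
move=> x; apply: le_trans (dotv_normalize_le1 x).
by apply: ler_sum => i _; rewrite soft0.
Qed.

(** At correlation 0 the two vectors are independent, so each coordinate contributes the square of a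
    mean. This yields the bound 1 on the infimum of the ratios. *)
Lemma Fstar0_ge0 : 0 <= Fstar k (0 : R).
Proof.
rewrite Fstar_stab; apply: sumr_ge0 => i _.
have bh := bmeas_soft i (lexx 0); have bc := bmeas_corr 0 bh.
suff -> : stab 0 (soft 0 i) = (\E (gauss k) (soft 0 i)) ^+ 2 by exact: sqr_ge0.
rewrite expr2 -expectZ//; apply: eq_expect => x; rewrite mulrC -expectZ//.
apply: eq_expect => y; rewrite /corr expr0n subr0 sqrtr1; congr (_ * soft 0 i _).
by apply: eq_from_tnth => j; rewrite tnth_mktuple mul0r add0r mul1r.
Qed.

End Fstar_le.

(** * Mean and variance under a product of finite pair laws *)

Section product_law.
Context {R : realType} (K : finType) (p : K -> K -> R) (n : nat).
Implicit Types a b : K -> K -> R.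

Definition pair_expect a : R := \sum_k \sum_l p k l * a k l.

Lemma pair_expectD a b : pair_expect (fun k l => a k l + b k l) =
  pair_expect a + pair_expect b.
Proof.
rewrite -big_split; apply: eq_bigr => k _ /=; rewrite -big_split.
by apply: eq_bigr => l _ /=; rewrite mulrDr.
Qed.

Lemma pair_expectZ c a : pair_expect (fun k l => c * a k l) = c * pair_expect a.
Proof.
rewrite mulr_sumr; apply: eq_bigr => k _; rewrite mulr_sumr.
by apply: eq_bigr => l _; ring.
Qed.

Lemma eq_pair_expect a b : (forall k l, a k l = b k l) ->
  pair_expect a = pair_expect b.
Proof. by move=> ab; apply: eq_bigr => k _; apply: eq_bigr => l _; rewrite ab. Qed.

Lemma le_pair_expect a b : (forall k l, 0 <= p k l) ->
  (forall k l, a k l <= b k l) -> pair_expect a <= pair_expect b.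
Proof.
move=> p0 ab; apply: ler_sum => k _; apply: ler_sum => l _.
by rewrite ler_wpM2l.
Qed.

Lemma pair_expect_ge0 a : (forall k l, 0 <= p k l) ->
  (forall k l, 0 <= a k l) -> 0 <= pair_expect a.
Proof.
by move=> p0 a0; apply: sumr_ge0 => k _; apply: sumr_ge0 => l _; rewrite mulr_ge0.
Qed.

Lemma pair_expect_cst c : \sum_k \sum_l p k l = 1 ->
  pair_expect (fun _ _ => c) = c.
Proof.
move=> p1; rewrite -[RHS]mul1r -p1 mulr_suml; apply: eq_bigr => k _.
by rewrite mulr_suml.
Qed.

(** For a joint law p, this is the law of two words formed by n independent pairs of letters. *)
Definition prod_weight (u v : {ffun 'I_n -> K}) : R := \prod_i p (u i) (v i).

Lemma sum_prod_pairs (F : 'I_n -> K -> K -> R) :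
  \sum_(u : {ffun 'I_n -> K}) \sum_(v : {ffun 'I_n -> K}) \prod_i F i (u i) (v i) =
  \prod_i \sum_k \sum_l F i k l.
Proof.
rewrite bigA_distr_bigA /=; apply: eq_bigr => u _.
by rewrite bigA_distr_bigA.
Qed.

Lemma prod_weight_expect (a : 'I_n -> K -> K -> R) :
  \sum_u \sum_v prod_weight u v * \prod_i a i (u i) (v i) =
  \prod_i pair_expect (a i).
Proof.
rewrite -(sum_prod_pairs (fun i k l => p k l * a i k l)).
by apply: eq_bigr => u _; apply: eq_bigr => v _; rewrite big_split.
Qed.

Hypothesis p1 : \sum_k \sum_l p k l = 1.

Lemma prod_weight_sum1 : \sum_u \sum_v prod_weight u v = 1.
Proof.
transitivity (\sum_u \sum_v prod_weight u v * \prod_(i < n) (fun _ _ => 1) (u i) (v i)).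
  by apply: eq_bigr => u _; apply: eq_bigr => v _; rewrite big1 ?mulr1.
by rewrite (prod_weight_expect (fun _ _ _ => 1)) big1// => i _; exact: pair_expect_cst.
Qed.

Lemma prod_weight_tnth a j :
  \sum_u \sum_v prod_weight u v * a (u j) (v j) = pair_expect a.
Proof.
pose F i k l := if i == j then a k l else 1.
transitivity (\prod_i pair_expect (F i)).
  rewrite -prod_weight_expect; apply: eq_bigr => u _; apply: eq_bigr => v _.
  congr (_ * _); rewrite (bigD1 j)//= big1 => [|i /negPf ij]; last by rewrite /F ij.
  by rewrite /F eqxx mulr1.
rewrite (bigD1 j)//= big1 => [|i /negPf ij]; last by rewrite /F ij pair_expect_cst.
by rewrite /F eqxx mulr1.
Qed.

Lemma prod_weight_tnth2 a j j' : j != j' ->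
  \sum_u \sum_v prod_weight u v * (a (u j) (v j) * a (u j') (v j')) =
  pair_expect a * pair_expect a.
Proof.
move=> jj'; pose F i k l := if (i == j) || (i == j') then a k l else 1.
have j'j : j' != j by rewrite eq_sym.
transitivity (\prod_i pair_expect (F i)).
  rewrite -prod_weight_expect; apply: eq_bigr => u _; apply: eq_bigr => v _.
  congr (_ * _); rewrite (bigD1 j)//= (bigD1 j')//= big1 => [|i /andP[/negPf ij /negPf ij']].
    by rewrite /F !eqxx orbT mulr1.
  by rewrite /F ij ij'.
rewrite (bigD1 j)//= (bigD1 j')//= big1 => [|i /andP[/negPf ij /negPf ij']].
  by rewrite /F !eqxx orbT mulr1.
by rewrite /F ij ij' pair_expect_cst.
Qed.

Lemma prod_weight_mean a :
  \sum_u \sum_v prod_weight u v * (\sum_j a (u j) (v j)) = n%:R * pair_expect a.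
Proof.
transitivity (\sum_(j < n) pair_expect a); last by rewrite sumr_const card_ord mulr_natl.
transitivity (\sum_(j < n) \sum_u \sum_v prod_weight u v * a (u j) (v j)); last first.
  by apply: eq_bigr => j _; exact: prod_weight_tnth.
rewrite [RHS]exchange_big; apply: eq_bigr => u _ /=; rewrite [RHS]exchange_big.
by apply: eq_bigr => v _; rewrite mulr_sumr.
Qed.

(** Terms at distinct positions factor into products of means and vanish, leaving the n diagonal
    terms. *)
Lemma prod_weight_var a : pair_expect a = 0 ->
  \sum_u \sum_v prod_weight u v * (\sum_j a (u j) (v j)) ^+ 2 =
  n%:R * pair_expect (fun k l => a k l ^+ 2).
Proof.
move=> a0.
transitivity (\sum_(j < n) pair_expect (fun k l => a k l ^+ 2));
  last by rewrite sumr_const card_ord mulr_natl.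
transitivity (\sum_(j < n) \sum_(j' < n) \sum_u \sum_v
    prod_weight u v * (a (u j) (v j) * a (u j') (v j'))); last first.
  apply: eq_bigr => j _; rewrite (bigD1 j)//= [X in _ + X]big1 ?addr0.
    rewrite -(prod_weight_tnth _ j).
    by apply: eq_bigr => u _; apply: eq_bigr => v _; rewrite expr2.
  by move=> i ij; rewrite prod_weight_tnth2 1?eq_sym// a0 mul0r.
under [RHS]eq_bigr => j _ do rewrite exchange_big /=.
rewrite [RHS]exchange_big; apply: eq_bigr => u _ /=.
under [RHS]eq_bigr => j _ do rewrite exchange_big /=.
rewrite [RHS]exchange_big; apply: eq_bigr => v _ /=.
rewrite expr2 mulr_suml mulr_sumr; apply: eq_bigr => j _.
by rewrite !mulr_sumr.
Qed.

End product_law.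

(** * Comparing vectors of norm close to 1 with their directions *)

Section embedding.
Context {R : realType}.

Definition padv n N (x : n.-tuple R) : N.-tuple R := [tuple nth 0 x i | i < N].

Lemma dotv_padv n N (x y : n.-tuple R) : (n <= N)%N ->
  dotv (padv N x) (padv N y) = dotv x y.
Proof.
move=> nN; rewrite /dotv.
transitivity (\sum_(i < N) nth 0 x i * nth 0 y i).
  by apply: eq_bigr => i _; rewrite !tnth_mktuple.
rewrite -(big_mkord xpredT (fun i => nth 0 x i * nth 0 y i)).
rewrite (big_cat_nat (n := n))//= [X in _ + X]big_nat_cond [X in _ + X]big1 ?addr0.
  by rewrite big_mkord; apply: eq_bigr => i _; rewrite !(tnth_nth 0).
by move=> i; rewrite andbT => /andP[ni _]; rewrite nth_default ?mul0r// size_tuple.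
Qed.

Lemma dotv_scale n (a b : R) (x y : n.-tuple R) :
  dotv [tuple a * tnth x i | i < n] [tuple b * tnth y i | i < n] = a * b * dotv x y.
Proof.
rewrite mulr_sumr; apply: eq_bigr => i _; rewrite !tnth_mktuple; ring.
Qed.

(* With x = r w and y = t z, <w, z> - <x, y> = <w, z> (1 - r t), and
   |1 - r t| <= |1 - r^2 t^2|. *)
Lemma dotv_polar_le n (w z : n.-tuple R) (r t eta : R) :
  dotv w w = 1 -> dotv z z = 1 -> 0 <= r -> 0 <= t -> 0 < eta ->
  dotv w z <= r * t * dotv w z + eta +
    (1 + eta^-1) / 2 * ((r ^+ 2 - 1) ^+ 2 + (t ^+ 2 - 1) ^+ 2).
Proof.
move=> w1 z1 r0 t0 eta0.
have /andP[c1 c2] : -1 <= dotv w z <= 1 by apply: dotv_unit_bound; rewrite ?w1 ?z1.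
set c := dotv w z in c1 c2 *; set a := r ^+ 2 - 1; set b := t ^+ 2 - 1.
have rt0 : 0 <= r * t by exact: mulr_ge0.
(* Applied to a and to b, this gives the total eta and the coefficient 1/(2 eta) of a^2 + b^2; the
   further 1/2 comes from |a b|. *)
have amgm (x : R) : `|x| <= (eta + eta^-1 * x ^+ 2) / 2.
  rewrite -(real_normK (num_real x)) -subr_ge0.
  have -> : (eta + eta^-1 * `|x| ^+ 2) / 2 - `|x| = (eta - `|x|) ^+ 2 / (2 * eta).
    by field; rewrite gt_eqF.
  by rewrite divr_ge0 ?sqr_ge0// mulr_ge0// ltW.
have h1 : c * (1 - r * t) <= `|1 - r * t|.
  rewrite (le_trans (ler_norm _))// normrM ler_piMl// ler_norml c1 c2//.
have h2 : `|1 - r * t| <= `|(r * t) ^+ 2 - 1|.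
  have -> : (r * t) ^+ 2 - 1 = (r * t - 1) * (r * t + 1) by ring.
  by rewrite normrM distrC ler_peMr// ger0_norm; lra.
have h3 : (r * t) ^+ 2 - 1 = a * b + a + b by rewrite /a /b; ring.
have h4 : `|a * b + a + b| <= `|a * b| + `|a| + `|b|.
  by rewrite (le_trans (ler_normD _ _))// lerD2r ler_normD.
have h5 : `|a * b| <= (a ^+ 2 + b ^+ 2) / 2.
  rewrite normrM -(real_normK (num_real a)) -(real_normK (num_real b)).
  have := sqr_ge0 (`|a| - `|b|); nra.
have := amgm a; have := amgm b; rewrite h3 in h2.
set ie := eta^-1; nra.
Qed.

End embedding.

(** * Removing loops *)

Section loopless.
Context {R : realType} (V : finType) (W : V -> V -> R).
Hypotheses (W0 : forall u v, 0 <= W u v) (W1 : \sum_u \sum_v W u v = 1).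

(** The factor X is common to all assignments and all dimensions, so it cancels in the ratio. A
    symmetric function vanishing on the diagonal sees neither the symmetrization of W nor the
    deletion of its loops. *)
Lemma loopless_graph : \sum_u W u u < 1 ->
  exists (G : @wgraph R V) (X : R), 0 < X /\
  forall d (f : V -> d.-tuple R), (forall v, dotv (f v) (f v) = 1) ->
    prod_val G f = X * \sum_u \sum_v W u v * (1 - dotv (f u) (f v)).
Proof.
move=> dlt1; set del := \sum_u W u u in dlt1.
(* Off the diagonal, W u v + W v u has total mass 2 (1 - del). *)
pose c := 2^-1 / (1 - del).
have c0 : 0 < c by rewrite divr_gt0// subr_gt0.
pose w u v := if u == v then 0 else c * (W u v + W v u).
have sumw (F : V -> V -> R) : (forall u v, F u v = F v u) -> (forall u, F u u = 0) ->
    \sum_u \sum_v w u v * F u v = 2 * c * \sum_u \sum_v W u v * F u v.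
  move=> Fsym F0.
  transitivity (c * (\sum_u \sum_v W u v * F u v + \sum_u \sum_v W v u * F u v)).
    rewrite -big_split mulr_sumr; apply: eq_bigr => u _ /=.
    rewrite -big_split mulr_sumr; apply: eq_bigr => v _ /=; rewrite /w.
    by case: eqVneq => [->|_]; rewrite ?F0; ring.
  have -> : \sum_u \sum_v W v u * F u v = \sum_u \sum_v W u v * F u v.
    by rewrite exchange_big; apply: eq_bigr => u _; apply: eq_bigr => v _; rewrite Fsym.
  ring.
have w0 u v : 0 <= w u v.
  by rewrite /w; case: ifP => // _; rewrite mulr_ge0 ?addr_ge0// ltW.
have wsym u v : w u v = w v u by rewrite /w eq_sym addrC.
have wloop u : w u u = 0 by rewrite /w eqxx.
have wsum : \sum_u \sum_v w u v = 1.
  transitivity (\sum_u \sum_v w u v * (1 - (u == v)%:R)).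
    apply: eq_bigr => u _; apply: eq_bigr => v _.
    by case: eqVneq => [->|_]; rewrite ?wloop ?mul0r// subr0 mulr1.
  rewrite sumw; last 2 first.
  - by move=> u v; rewrite eq_sym.
  - by move=> u; rewrite eqxx subrr.
  have -> : \sum_u \sum_v W u v * (1 - (u == v)%:R) = 1 - del.
    rewrite -[in RHS]W1 -sumrB; apply: eq_bigr => u _.
    rewrite [LHS](bigD1 u)//= [in RHS](bigD1 u)//= eqxx subrr mulr0 add0r addrAC subrr add0r.
    by apply: eq_bigr => v vu; rewrite eq_sym (negPf vu) subr0 mulr1.
  by rewrite /c mulrA divff ?pnatr_eq0// mul1r mulVf// gt_eqF// subr_gt0.
exists (WGraph w0 wsym wloop wsum), (2 * c / 4); split.
  by rewrite divr_gt0// mulr_gt0.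
move=> d f f1; rewrite /prod_val /=.
transitivity (4^-1 * \sum_u \sum_v w u v * (1 - dotv (f u) (f v))).
  rewrite mulr_sumr; apply: eq_bigr => u _; rewrite mulr_sumr; apply: eq_bigr => v _.
  ring.
rewrite sumw; first by ring.
- by move=> u v; rewrite dotvC.
- by move=> u; rewrite f1 subrr.
Qed.

End loopless.

(** * Quantizing one Gaussian coordinate *)

Section quantizer.
Context {R : realType}.
Local Notation mR := (measurableTypeR R).
Local Notation gg := (gauss1 \x gauss1)%E.

Definition gauss_var : R := \E gauss1 (fun x : mR => x ^+ 2).

(** If it were 0, x^2 would vanish almost everywhere and all the mass would sit at the origin, which
    is a null set. *)
Lemma gauss_var_gt0 : 0 < gauss_var.
Proof.
have i2 := @integrable_sqr_gauss1 R.
rewrite lt_neqAle eq_sym; apply/andP; split; last first.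
  by apply: Rintegral_ge0 => x _; exact: sqr_ge0.
apply/negP => /eqP v0.
have m2 : measurable_fun [set: mR] (fun x : mR => (x ^+ 2)%:E : \bar R).
  exact: measurable_int i2.
have /(ae_eq_integral_abs _ measurableT m2) : (\int[gauss1]_x `|(x ^+ 2)%:E| = 0 :> \bar R)%E.
  transitivity (\int[gauss1]_x (x ^+ 2)%:E : \bar R)%E.
    by apply: eq_integral => x _; rewrite gee0_abs// lee_fin sqr_ge0.
  rewrite -[LHS]fineK; first by rewrite -[fine _]/gauss_var v0.
  exact: integrable_fin_num i2.
move=> -[N [mN N0 sub]].
have pt : gauss1 [set (0 : mR)] = 0%E.
  by rewrite /gauss1 /= /normal_prob integral_set1.
have : (gauss1 [set: mR] <= gauss1 N + gauss1 [set 0%R : mR])%E.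
  apply: (@le_trans _ _ (gauss1 (N `|` [set 0%R : mR]))).
    apply: le_measure; rewrite ?inE//; first exact: measurableU.
    move=> x _; have [->|x0] := eqVneq x 0; [by right|left].
    by apply: sub => /= /(_ I)[] /eqP; rewrite sqrf_eq0 (negPf x0).
  exact: measureU2.
by rewrite probability_setT N0 pt add0e lee_fin ler10.
Qed.

Import HBSimple HBNNSimple.

(** Approximate the positive and the negative part from below by simple functions and subtract. At
    each x at most one part is nonzero, which gives the domination by |x|. *)
Lemma simple_approx_id : exists Q : nat -> R -> R,
  [/\ forall n, measurable_fun [set: mR] (Q n : mR -> mR), forall n, finite_set (range (Q n)),
      forall n x, `|Q n x| <= `|x| & forall x, Q n x @[n --> \oo] --> x].
Proof.
have mp : measurable_fun [set: mR] (fun x : mR => (Num.max x 0)%:E : \bar R).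
  by apply/measurable_EFinP; apply: measurable_maxr.
have mn : measurable_fun [set: mR] (fun x : mR => (Num.max (- x) 0)%:E : \bar R).
  by apply/measurable_EFinP; apply: measurable_maxr => //; exact: measurableT_comp.
pose fp := nnsfun_approx measurableT mp; pose fn := nnsfun_approx measurableT mn.
have p0 (x : mR) : [set: mR] x -> (0 <= (Num.max x 0)%:E :> \bar R)%E.
  by rewrite lee_fin le_max lexx orbT.
have n0 (x : mR) : [set: mR] x -> (0 <= (Num.max (- x) 0)%:E :> \bar R)%E.
  by rewrite lee_fin le_max lexx orbT.
have fp_le n x : 0 <= fp n x <= Num.max x 0.
  rewrite fun_ge0 /= -lee_fin /fp nnsfun_approxE; by apply: le_approx.
have fn_le n x : 0 <= fn n x <= Num.max (- x) 0.
  rewrite fun_ge0 /= -lee_fin /fn nnsfun_approxE; by apply: le_approx.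
exists (fun n => ((fp n \+ cst (-1) \* fn n : {sfun mR >-> R}) : R -> R)); split.
- by move=> n; exact: (measurable_funPT (fp n \+ cst (-1) \* fn n)).
- by move=> n; exact: (fimfunP (fp n \+ cst (-1) \* fn n)).
- move=> n x; have /andP[p1 p2] := fp_le n x; have /andP[n1 n2] := fn_le n x.
  rewrite /= /cst mulN1r ler_norml.
  have [x0|x0] := leP 0 x.
    rewrite max_l// in p2; rewrite max_r ?oppr_le0// in n2.
    by rewrite ger0_norm//; lra.
  rewrite max_r ?(ltW x0)// in p2; rewrite max_l ?oppr_ge0 ?(ltW x0)// in n2.
  by rewrite ltr0_norm//; lra.
- move=> x.
  have cp : fp n x @[n --> \oo] --> Num.max x 0.
    exact: (fine_cvg (cvg_nnsfun_approx measurableT mp p0 I)).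
  have cn : fn n x @[n --> \oo] --> Num.max (- x) 0.
    exact: (fine_cvg (cvg_nnsfun_approx measurableT mn n0 I)).
  have {2}-> : x = Num.max x 0 + (-1) * Num.max (- x) 0.
    have [x0|x0] : 0 <= x \/ x < 0 by case: (lerP 0 x) => ?; [left|right].
      by rewrite mulN1r max_l// max_r ?oppr_le0// subr0.
    by rewrite mulN1r max_r ?(ltW x0)// max_l ?oppr_ge0 ?(ltW x0)// opprK add0r.
  by apply: cvgD => //; apply: cvgM => //; exact: cvg_cst.
Qed.

Lemma integrable_fst d d' (T : measurableType d) (T' : measurableType d')
    (P : probability T R) (Q : probability T' R) (f : T -> R) :
  P.-integrable [set: T] (EFin \o f) ->
  (P \x Q)%E.-integrable [set: T * T'] (EFin \o (f \o fst)).
Proof.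
move=> /integrableP[mf fi].
apply/integrable12ltyP; first exact: (measurableT_comp mf measurable_fst).
rewrite (eq_integral (fun x => `|(f x)%:E|))%E//= => x _.
by rewrite integral_cst// -[X in (_ * X)%E]/(Q setT) probability_setT mule1.
Qed.

Lemma integrable_snd d d' (T : measurableType d) (T' : measurableType d')
    (P : probability T R) (Q : probability T' R) (f : T' -> R) :
  Q.-integrable [set: T'] (EFin \o f) ->
  (P \x Q)%E.-integrable [set: T * T'] (EFin \o (f \o snd)).
Proof.
move=> /integrableP[mf fi].
apply/integrable21ltyP; first exact: (measurableT_comp mf measurable_snd).
rewrite (eq_integral (fun x => `|(f x)%:E|))%E//= => x _.
by rewrite integral_cst// -[X in (_ * X)%E]/(P setT) probability_setT mule1.
Qed.

Lemma expect_fst d d' (T : measurableType d) (T' : measurableType d')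
    (P : probability T R) (Q : probability T' R) (f : T -> R) :
  P.-integrable [set: T] (EFin \o f) -> \E (P \x Q)%E (f \o fst) = \E P f.
Proof.
move=> fi; symmetry.
apply: (integrable_expect_pushforward (P := (P \x Q)%E) (phi := fst)) => //.
- move=> A mA; rewrite (_ : fst @^-1` A = A `*` setT); last first.
    by apply/seteqP; split=> [[x y] /=|[x y] /= []].
  apply/esym; apply: etrans (product_measure1E P Q mA measurableT) _.
  by rewrite -[X in (_ * X)%E]/(Q setT) probability_setT mule1.
- by apply/measurable_EFinP; case/integrableP: fi.
- exact: integrable_fst.
Qed.

Lemma integrable_sqr_sum (C : R) :
  gg.-integrable setT (EFin \o (fun p : mR * mR => C * (p.1 ^+ 2 + p.2 ^+ 2))).
Proof.
have i1 := integrable_fst gauss1 (@integrable_sqr_gauss1 R).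
have i2 := integrable_snd gauss1 (@integrable_sqr_gauss1 R).
apply: (eq_integrable _ (fun p => C%:E * (((p : mR * mR).1 ^+ 2)%:E + (p.2 ^+ 2)%:E))%E) => //.
by apply: integrableZl => //; exact: (integrableD _ i1 i2).
Qed.

Lemma le_integrable_sqr_sum (C : R) (f : mR * mR -> R) :
  measurable_fun setT f ->
  (forall p, `|f p| <= C * (p.1 ^+ 2 + p.2 ^+ 2)) -> gg.-integrable setT (EFin \o f).
Proof.
move=> mf fC; apply: (le_integrable _ _ _ (integrable_sqr_sum C)) => //.
  exact/measurable_EFinP.
by move=> p _; rewrite lee_fin (le_trans (fC p))// ler_norm.
Qed.

Lemma abs_mul_le (x y : R) : `|x * y| <= x ^+ 2 + y ^+ 2.
Proof.
rewrite normrM -(real_normK (num_real x)) -(real_normK (num_real y)).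
have := sqr_ge0 (`|x| - `|y|); have := sqr_ge0 (`|x| + `|y|); nra.
Qed.

Lemma measurable_mul12 : measurable_fun [set: mR * mR] (fun p : mR * mR => p.1 * p.2).
Proof. by apply: measurable_funM. Qed.

(** The quarter turn (x, y) -> (-y, x) preserves the law and changes the sign of x y. *)
Lemma expect_mul12 : \E gg (fun p : mR * mR => p.1 * p.2) = 0.
Proof.
have i12 : gg.-integrable setT (EFin \o (fun p : mR * mR => p.1 * p.2)).
  apply: (le_integrable_sqr_sum (C := 1)); first exact: measurable_mul12.
  by move=> p; rewrite mul1r; exact: abs_mul_le.
have cs : (0 : R) ^+ 2 + 1 ^+ 2 = 1 by ring.
have mrot := measurable_rotation (0 : R) 1.
have := @integrable_expect_pushforward R _ _ _ _ gg gg _ _ mrot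
  (fun A mA => gauss1_rotation cs mA) measurable_mul12.
rewrite /= (_ : (fun x : mR * mR => (0 * x.1 - 1 * x.2) * (1 * x.1 + 0 * x.2)) =
  (fun p => (-1) * (p.1 * p.2))); last by apply/funext => p; ring.
rewrite RintegralZl// => H.
suff e : \E gg (fun p : mR * mR => p.1 * p.2) =
  -1 * \E gg (fun p : mR * mR => p.1 * p.2).
  by move: e; clear; move: (\E gg _) => z; lra.
apply: H; apply: (eq_integrable _ (fun p : mR * mR => (-1)%:E * (p.1 * p.2)%:E)%E) => //.
  by move=> p _ /=; rewrite -EFinM; congr EFin; ring.
exact: integrableZl.
Qed.

Lemma bmeas_alphabet (K : finType) (kap : R -> K) (a : K -> R) :
  (forall k, bmeas (fun x : mR => (kap x == k)%:R : R)) -> bmeas (fun x : mR => a (kap x)).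
Proof.
move=> bk.
rewrite (_ : (fun x : mR => _) = fun x : mR => \sum_k a k * (kap x == k)%:R).
  by apply: bmeas_sum => k; apply: bmeasM => //; exact: bmeas_cst.
apply/funext => x; rewrite (bigD1 (kap x))//= eqxx mulr1 big1 ?addr0// => k.
by rewrite eq_sym => /negPf ->; rewrite mulr0.
Qed.

Lemma measurable_corr1 (rho s : R) :
  measurable_fun [set: mR * mR] (fun p : mR * mR => rho * p.1 + s * p.2 : mR).
Proof. by apply: measurable_funD; apply: measurable_funM. Qed.

(** Without quantization the left side minus the right side is -eps times the variance, which is
    negative. By dominated convergence a fine enough simple approximation of the identity keeps this
    sign; its values serve as letters. *)
Lemma quantizer (rho eps : R) : -1 <= rho <= 1 -> 0 < eps ->
  exists (K : finType) (kap : R -> K) (q : K -> R),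
  [/\ (1 < #|K|)%N, forall k, bmeas (fun x : mR => (kap x == k)%:R : R) &
   \E gauss1 (fun x => \E gauss1 (fun y =>
     q (kap x) * q (kap (rho * x + Num.sqrt (1 - rho ^+ 2) * y)))) <
   (rho + eps) * \E gauss1 (fun x => q (kap x) ^+ 2)].
Proof.
move=> /andP[rho0 rho1] eps0; set s := Num.sqrt _.
have rho2 : rho ^+ 2 <= 1 by rewrite expr2; nra.
have s2 : s ^+ 2 = 1 - rho ^+ 2 by rewrite sqr_sqrtr// subr_ge0.
have rho2ge0 := sqr_ge0 rho; have s2ge0 := sqr_ge0 s.
have [Q [mQ fQ Qle Qcv]] := simple_approx_id.
pose Y (p : mR * mR) : mR := rho * p.1 + s * p.2.
pose f n (p : mR * mR) := Q n p.1 * Q n (Y p) - (rho + eps) * (Q n p.1 * Q n p.1).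
pose f0 (p : mR * mR) := p.1 * Y p - (rho + eps) * (p.1 * p.1).
have mY : measurable_fun setT Y := measurable_corr1 rho s.
have Y2 p : Y p ^+ 2 <= 2 * (p.1 ^+ 2 + p.2 ^+ 2).
  have h : Y p ^+ 2 + (rho * p.1 - s * p.2) ^+ 2 =
      2 * (rho ^+ 2 * p.1 ^+ 2 + s ^+ 2 * p.2 ^+ 2) by rewrite /Y; ring.
  have := sqr_ge0 (rho * p.1 - s * p.2); have := sqr_ge0 p.1; have := sqr_ge0 p.2.
  have h1 : rho ^+ 2 * p.1 ^+ 2 <= p.1 ^+ 2 by rewrite ler_piMl// sqr_ge0.
  have h2 : s ^+ 2 * p.2 ^+ 2 <= p.2 ^+ 2 by rewrite ler_piMl// ?sqr_ge0//; lra.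
  lra.
(* The 3 comes from |x Y| <= x^2 + Y^2 and Y^2 <= 2 (x^2 + y^2). *)
have fle n p : `|f n p| <= (3 + `|rho + eps|) * (p.1 ^+ 2 + p.2 ^+ 2).
  rewrite (le_trans (ler_normB _ _))// [leRHS]mulrDl lerD//.
    rewrite normrM (le_trans (ler_pM _ _ (Qle n p.1) (Qle n (Y p))))//.
    rewrite -normrM (le_trans (abs_mul_le _ _))//.
    have := Y2 p; have := sqr_ge0 p.2; lra.
  rewrite normrM ler_wpM2l// normrM (le_trans (ler_pM _ _ (Qle n p.1) (Qle n p.1)))//.
  by rewrite -expr2 real_normK ?num_real// lerDl sqr_ge0.
have mf n : measurable_fun setT (f n).
  have mQ1 : measurable_fun [set: mR * mR] (fun p : mR * mR => Q n p.1).
    exact: (measurableT_comp (mQ n)).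
  apply: measurable_funB; first by apply: measurable_funM => //; exact: (measurableT_comp (mQ n)).
  by apply: measurable_funM => //; apply: measurable_funM.
have mf0 : measurable_fun setT f0.
  apply: measurable_funB; first exact: measurable_funM.
  by apply: measurable_funM => //; apply: measurable_funM.
have cv : \E gg (f n) @[n --> \oo] --> \E gg f0.
  apply: (expect_dominated mf mf0 (integrable_sqr_sum (3 + `|rho + eps|)) fle).
  move=> p; apply: cvgB; first by apply: cvgM; exact: Qcv.
  by apply: cvgM; [exact: cvg_cst|apply: cvgM; exact: Qcv].
have lim_lt0 : \E gg f0 < 0.
  have i1 : gg.-integrable setT (EFin \o (fun p : mR * mR => s * (p.1 * p.2))).
    apply: (le_integrable_sqr_sum (C := `|s|)).
      by apply: measurable_funM => //; exact: measurable_mul12.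
    by move=> p; rewrite normrM ler_wpM2l// abs_mul_le.
  have i2' := integrable_fst gauss1 (@integrable_sqr_gauss1 R).
  have i2 : gg.-integrable setT (EFin \o (fun p : mR * mR => eps * p.1 ^+ 2)).
    apply: (eq_integrable _ (fun p : mR * mR => eps%:E * (p.1 ^+ 2)%:E)%E) => //.
    exact: integrableZl.
  rewrite (_ : f0 = fun p => s * (p.1 * p.2) - eps * p.1 ^+ 2); last first.
    by apply/funext => p; rewrite /f0 /Y; ring.
  have i12 : gg.-integrable setT (EFin \o (fun p : mR * mR => p.1 * p.2)).
    apply: (le_integrable_sqr_sum (C := 1)); first exact: measurable_mul12.
    by move=> p; rewrite mul1r; exact: abs_mul_le.
  rewrite RintegralB// (RintegralZl s measurableT i12).
  rewrite expect_mul12 mulr0 sub0r oppr_lt0 (RintegralZl eps measurableT i2') mulr_gt0//.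
  by rewrite (expect_fst gauss1 (@integrable_sqr_gauss1 R)) gauss_var_gt0.
have [n fn0] : exists n, \E gg (f n) < 0.
  have [N _ HN] := cvgr_lt _ cv _ lim_lt0.
  by exists N; apply: HN => /=.
have /finite_seqP[r rE] := fQ n.
have Qr x : Q n x \in r.
  have : range (Q n) (Q n x) by exists x.
  by rewrite rE.
(* The two dummy letters make #|K| > 1, so that R^n embeds in R^(#|K|^n). *)
pose K : finType := (seq_sub r + bool)%type.
pose kap x : K := inl (SeqSub (Qr x)).
pose q (k : K) : R := if k is inl z then val z else 0.
have bk k : bmeas (fun x : mR => (kap x == k)%:R : R).
  case: k => [z|b]; last exact: (bmeas_cst _ 0).
  split; last by exists 1 => x; case: (_ == _); rewrite ?normr1 ?normr0 ?ler01.
  rewrite (_ : (fun x => _) = \1_((Q n : mR -> mR) @^-1` [set val z])).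
    apply: measurable_indic; rewrite -[_ @^-1` _]setTI; exact: mQ.
  apply/funext => x; rewrite indicE; congr (nat_of_bool _)%:R.
  by apply/idP/idP => [/eqP [<-]|]; rewrite inE//= => Qx; apply/eqP; congr inl; exact: val_inj.
exists K, kap, q; split => //.
  by rewrite card_sum card_bool addn2.
have bq := bmeas_alphabet q bk.
have b1 : bmeas (fun p : mR * mR => q (kap p.1) * q (kap (Y p))).
  by apply: bmeasM; apply: (bmeas_comp bq).
have b2 : bmeas (fun p : mR * mR => q (kap p.1) ^+ 2).
  by apply: bmeasM; apply: (bmeas_comp bq).
have b3 : bmeas (fun p : mR * mR => (rho + eps) * q (kap p.1) ^+ 2).
  by apply: bmeasM => //; exact: bmeas_cst.
rewrite -subr_lt0; apply: le_lt_trans fn0; rewrite le_eqVlt; apply/orP; left; apply/eqP.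
transitivity (\E gg (fun p => q (kap p.1) * q (kap (Y p)) - (rho + eps) * q (kap p.1) ^+ 2)).
  rewrite expectB// expect_prod// expectZ// expect_prod//; congr (_ - _ * _).
  by apply: eq_expect => x /=; rewrite expect_cst.
by apply: eq_expect => p; rewrite /f expr2.
Qed.

End quantizer.

(** * The law of the cells of two correlated Gaussian vectors *)

Section cells.
Context {R : realType} (K : finType) (kap : R -> K) (rho : R).
Local Notation mR := (measurableTypeR R).
Local Notation V n := (n.-tuple mR).
Local Notation s := (Num.sqrt (1 - rho ^+ 2)).
Hypothesis bk : forall k, bmeas (fun x : mR => (kap x == k)%:R : R).
Hypothesis rho1 : -1 <= rho <= 1.

Definition pair_law k l : R :=
  \E gauss1 (fun x => \E gauss1 (fun y =>
    (kap x == k)%:R * (kap (rho * x + s * y) == l)%:R)).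

Let b_pair k l : bmeas (fun p : mR * mR =>
  (kap p.1 == k)%:R * (kap (rho * p.1 + s * p.2) == l)%:R : R).
Proof.
by apply: bmeasM; apply: (bmeas_comp (bk _)) => //; exact: measurable_corr1.
Qed.

Lemma sum_indicator (T : finType) (a : T -> R) (t : T) :
  \sum_k (t == k)%:R * a k = a t.
Proof.
rewrite (bigD1 t)//= eqxx mul1r big1 ?addr0// => k.
by rewrite eq_sym => /negPf ->; rewrite mul0r.
Qed.

Lemma pair_expectE (a : K -> K -> R) : pair_expect pair_law a =
  \E gauss1 (fun x => \E gauss1 (fun y => a (kap x) (kap (rho * x + s * y)))).
Proof.
rewrite /pair_expect.
have bp k l : bmeas (fun p : mR * mR => a k l *
    ((kap p.1 == k)%:R * (kap (rho * p.1 + s * p.2) == l)%:R)).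
  by apply: bmeasM => //; exact: bmeas_cst.
transitivity (\sum_k \sum_l \E gauss1 (fun x => \E gauss1 (fun y =>
    a k l * ((kap x == k)%:R * (kap (rho * x + s * y) == l)%:R)))).
  apply: eq_bigr => k _; apply: eq_bigr => l _; rewrite mulrC.
  rewrite -expectZ; last exact: (bmeas_expect gauss1 (b_pair k l)).
  by apply: eq_expect => x; rewrite -expectZ//; exact: (bmeas_section x (b_pair k l)).
under eq_bigr => k _.
  rewrite -expect_sum; last by move=> l; exact: (bmeas_expect gauss1 (bp k l)).
  over.
rewrite -expect_sum; last first.
  by move=> k; apply: bmeas_sum => l; exact: (bmeas_expect gauss1 (bp k l)).
apply: eq_expect => x.
under eq_bigr => k _.
  rewrite -expect_sum; last by move=> l; exact: (bmeas_section x (bp k l)).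
  over.
rewrite -expect_sum; last first.
  by move=> k; apply: bmeas_sum => l; exact: (bmeas_section x (bp k l)).
apply: eq_expect => y.
rewrite -[RHS](sum_indicator (fun k => a k (kap (rho * x + s * y)))).
apply: eq_bigr => k _; rewrite -[in RHS](sum_indicator (a k)) mulr_sumr.
by apply: eq_bigr => l _; ring.
Qed.

Lemma pair_law_ge0 k l : 0 <= pair_law k l.
Proof.
by apply: Rintegral_ge0 => x _; apply: Rintegral_ge0 => y _; rewrite mulr_ge0.
Qed.

Lemma pair_law_sum1 : \sum_k \sum_l pair_law k l = 1.
Proof.
transitivity (pair_expect pair_law (fun _ _ => 1)).
  by apply: eq_bigr => k _; apply: eq_bigr => l _; rewrite mulr1.
by rewrite pair_expectE -[RHS](expect_cst gauss1); apply: eq_expect => x;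
   exact: expect_cst.
Qed.

Lemma pair_expect_fst (b : K -> R) : pair_expect pair_law (fun k _ => b k) =
  \E gauss1 (fun x => b (kap x)).
Proof. by rewrite pair_expectE; apply: eq_expect => x; exact: expect_cst. Qed.

(** The second vector rho x + s y is the first coordinate of a rotated pair, hence again standard
    Gaussian. *)
Lemma pair_expect_snd (b : K -> R) : pair_expect pair_law (fun _ l => b l) =
  \E gauss1 (fun x => b (kap x)).
Proof.
rewrite pair_expectE.
have cs : rho ^+ 2 + (- s) ^+ 2 = 1.
  rewrite sqrrN sqr_sqrtr ?subrKC// subr_ge0 expr2.
  by move: rho1; nra.
have bb : bmeas (fun p : mR * mR => b (kap p.1)).
  by apply: (bmeas_comp (bmeas_alphabet b bk)).
transitivity (\E gauss1 (fun x => \E gauss1 (fun=> b (kap x)))); last first.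
  by apply: eq_expect => x; exact: expect_cst.
apply: etrans (expect_gauss1_rotation cs bb).
by apply: eq_expect => x; apply: eq_expect => y /=; rewrite mulNr opprK.
Qed.

Lemma expect_prod_tnth d (T : measurableType d) (P : probability T R) n
    (c : 'I_n -> T -> R) : (forall i, bmeas (c i)) ->
  \E (tuple_prob P n) (fun z => \prod_i c i (tnth z i)) = \prod_i \E P (c i).
Proof.
have bprod m (c0 : 'I_m -> T -> R) : (forall i, bmeas (c0 i)) ->
    bmeas (fun z : m.-tuple T => \prod_i c0 i (tnth z i)).
  by move=> bc; apply: bmeas_prod => i; apply: (bmeas_comp (bc i)); exact: measurable_tnth.
elim: n c => [|n IH] c bc.
  rewrite expect_tuple_prob0; last exact: (bprod _ c bc).
  by rewrite !big_ord0.
rewrite expect_tuple_probS; last exact: (bprod _ c bc).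
rewrite big_ord_recl -IH; last by move=> i; exact: bc.
rewrite mulrC -expectZ//; apply: eq_expect => t.
rewrite mulrC -expectZ; last exact: (bprod _ (fun i => c (lift ord0 i)) (fun i => bc _)).
apply: eq_expect => z; rewrite big_ord_recl tnth0; congr (_ * _).
by apply: eq_bigr => i _; rewrite tnthS.
Qed.

Variable n : nat.

Definition cell (x : V n) : {ffun 'I_n -> K} := [ffun i => kap (tnth x i)].

Lemma cell_indicator x u : (cell x == u)%:R = \prod_i (kap (tnth x i) == u i)%:R :> R.
Proof.
case: eqVneq => [<-|xu]; first by rewrite big1// => i _; rewrite ffunE eqxx.
suff [i xi] : exists i, kap (tnth x i) != u i.
  by rewrite (bigD1 i)//= (negPf xi) mul0r.
apply/existsP; rewrite -negb_forall; apply: contra xu => /forallP H.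
by apply/eqP/ffunP => i; rewrite ffunE; apply/eqP/H.
Qed.

Lemma bmeas_cell (a : {ffun 'I_n -> K} -> R) : bmeas (fun x : V n => a (cell x)).
Proof.
rewrite (_ : (fun x : V n => _) =
  fun x => \sum_(u : {ffun 'I_n -> K}) (\prod_i (kap (tnth x i) == u i)%:R) * a u).
  apply: bmeas_sum => u; apply: bmeasM; last exact: bmeas_cst.
  apply: bmeas_prod => i; apply: (bmeas_comp (bk (u i))); exact: measurable_tnth.
apply/funext => x; rewrite -[LHS]sum_indicator.
by apply: eq_bigr => u _; rewrite cell_indicator.
Qed.

Variable Phi : {ffun 'I_n -> K} -> {ffun 'I_n -> K} -> R.
Let term (u v : {ffun 'I_n -> K}) (x z : V n) : R :=
  \prod_i ((kap (tnth x i) == u i)%:R * (kap (rho * tnth x i + s * tnth z i) == v i)%:R).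

Let bterm u v : bmeas (fun q : V n * V n => term u v q.1 q.2).
Proof.
apply: bmeas_prod => i.
apply: (bmeas_comp (b_pair (u i) (v i))
  (g := fun q : V n * V n => (tnth q.1 i : mR, tnth q.2 i : mR))).
by apply: measurable_fun_pair;
   apply: (measurableT_comp (measurable_tnth i)).
Qed.

Let termE x z : Phi (cell x) (cell (lincomb rho x s z)) =
  \sum_u \sum_v Phi u v * term u v x z.
Proof.
rewrite -[LHS](sum_indicator (fun u => Phi u (cell (lincomb rho x s z)))).
apply: eq_bigr => u _; rewrite -[in LHS](sum_indicator (Phi u)) mulr_sumr.
apply: eq_bigr => v _; rewrite !cell_indicator mulrA mulrC -big_split /=.
by congr (_ * _); apply: eq_bigr => i _; rewrite tnth_mktuple.
Qed.

Lemma bmeas_cell_pair :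
  bmeas (fun q : V n * V n => Phi (cell q.1) (cell (lincomb rho q.1 s q.2))).
Proof.
rewrite (_ : (fun q => _) = fun q => \sum_u \sum_v Phi u v * term u v q.1 q.2).
  apply: bmeas_sum => u; apply: bmeas_sum => v.
  by apply: bmeasM => //; exact: bmeas_cst.
by apply/funext => q; exact: termE.
Qed.

(** Expanding [Phi] over indicators of cells gives integrands that are products over coordinates;
    independence of the coordinates turns their means into products of [pair_law]. *)
Lemma cell_pair_expect :
  \E (gauss n) (fun x => \E (gauss n) (fun z =>
    Phi (cell x) (cell (lincomb rho x s z)))) =
  \sum_u \sum_v prod_weight pair_law u v * Phi u v.
Proof.
have bt u v : bmeas (fun q : V n * V n => Phi u v * term u v q.1 q.2).
  by apply: bmeasM => //; exact: bmeas_cst.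
rewrite (_ : (fun x => _) = fun x => \sum_u \sum_v
    \E (gauss n) (fun z => Phi u v * term u v x z)); last first.
  apply/funext => x; under eq_expect do rewrite termE.
  rewrite expect_sum; last first.
    by move=> u; apply: bmeas_sum => v; exact: (bmeas_section x (bt u v)).
  by apply: eq_bigr => u _; rewrite expect_sum// => v; exact: (bmeas_section x (bt u v)).
rewrite expect_sum; last first.
  by move=> u; apply: bmeas_sum => v; exact: (bmeas_expect _ (bt u v)).
apply: eq_bigr => u _; rewrite expect_sum; last first.
  by move=> v; exact: (bmeas_expect _ (bt u v)).
apply: eq_bigr => v _; rewrite [RHS]mulrC.
transitivity (\E (gauss n) (fun x => Phi u v * \E (gauss n) (term u v x))).
  by apply: eq_expect => x; rewrite expectZ//; exact: (bmeas_section x (bterm u v)).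
rewrite expectZ; last exact: (bmeas_expect _ (bterm u v)).
congr (_ * _).
have bi i := b_pair (u i) (v i).
transitivity (\E (gauss n) (fun x => \prod_i \E gauss1 (fun y =>
    (kap (tnth x i) == u i)%:R * (kap (rho * tnth x i + s * y) == v i)%:R))).
  apply: eq_expect => x.
  by apply: expect_prod_tnth => i; exact: (bmeas_section (tnth x i) (bi i)).
by apply: (expect_prod_tnth gauss1 (fun i => bmeas_expect gauss1 (bi i))).
Qed.

End cells.

(** * Stability of the conjectured optimum *)

Section stability.
Context {R : realType}.
Local Notation mR := (measurableTypeR R).

(** The leading coordinates are integrated outermost, so the n trailing ones integrate a
    constant. *)
Lemma gauss_exp_first3 n (G : 3.-tuple R -> R) :
  @gauss_exp R n.+3 (fun x => G [tuple nth 0 x i | i < 3]) = gauss_exp G.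
Proof.
rewrite /=; apply: eq_Rintegral => t1 _; apply: eq_Rintegral => t2 _.
apply: eq_Rintegral => t3 _; rewrite -[RHS](gauss_exp_cst n).
apply: eq_gauss_exp => x; congr G; apply: eq_from_tnth => i.
by rewrite tnth_mktuple (tnth_nth 0); case: i => -[|[|[|]]].
Qed.

Lemma Stab_fopt3 n (rho : R) : Stab rho (@fopt3 R n.+3) = Fstar 3 rho.
Proof.
rewrite /Stab /Fstar -(gauss_exp_first3 n); apply: eq_gauss_exp => x.
rewrite -(gauss_exp_first3 n); apply: eq_gauss_exp => z; rewrite lincomb10.
congr (dotv _ (normalize _)); apply: eq_from_tnth => i.
have in3 : (i < n.+3)%N by rewrite (leq_trans (ltn_ord i)).
rewrite !tnth_mktuple -(tnth_nth 0 _ (Ordinal in3)) tnth_mktuple.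
by rewrite !(tnth_nth 0).
Qed.

End stability.

(** * Hard instances and the upper bound on the ratio *)

Section hard_instance.
Context {R : realType}.
Local Notation mR := (measurableTypeR R).

(** The factor X, due to the removal of loops, is shared by both bounds, so their quotient is at
    most (1 - [Fstar] 3 rho) / (1 - rho - 3 eps). *)
Lemma hard_instance (rho eps : R) : @H3 R -> -1 <= rho <= 0 -> 0 < eps ->
  0 < 1 - rho - 3 * eps ->
  exists (V : finType) (G : @wgraph R V) (X : R), [/\ 0 < X,
    Prod G <= X * (1 - Fstar 3 rho) & X * (1 - rho - 3 * eps) <= SDP_Prod G].
Proof.
move=> h3 rho01 eps0 gap.
have rho11 : -1 <= rho <= 1 by move: rho01; lra.
have [K [kap [q [K1 bk hq]]]] := quantizer rho11 eps0.
pose p := pair_law kap rho.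
have p0 := pair_law_ge0 kap rho : forall k l, 0 <= p k l.
have p1 : \sum_k \sum_l p k l = 1 := pair_law_sum1 rho bk.
pose m := \E gauss1 (fun x : mR => q (kap x) ^+ 2).
have mfst : pair_expect p (fun k _ => q k ^+ 2) = m.
  exact: (pair_expect_fst rho bk (fun k => q k ^+ 2)).
have msnd : pair_expect p (fun _ l => q l ^+ 2) = m.
  exact: (pair_expect_snd bk rho11 (fun k => q k ^+ 2)).
have {}hq : pair_expect p (fun k l => q k * q l) < (rho + eps) * m.
  by rewrite (pair_expectE rho bk (fun k l => q k * q l)).
(* If m were 0, the mean of q(k) q(l) would be negative, against the nonnegative mean of (q(k) +
   q(l))^2. *)
have m0 : 0 < m.
  have h : 0 <= pair_expect p (fun k l => 2 * (q k * q l) + (q k ^+ 2 + q l ^+ 2)).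
    apply: (pair_expect_ge0 p0) => k l; have := sqr_ge0 (q k + q l); lra.
  have m_ge0 : 0 <= m by rewrite -mfst; apply: (pair_expect_ge0 p0) => k l; exact: sqr_ge0.
  move: h; rewrite pair_expectD pair_expectZ pair_expectD mfst msnd => h.
  rewrite lt_neqAle m_ge0 andbT eq_sym; apply/negP => /eqP m00.
  by move: hq h; rewrite m00; lra.
have mn0 : m != 0 by rewrite gt_eqF.
(* Centred contributions of one coordinate to the squared norms of the two quantized vectors. *)
pose phi1 (k _ : K) := m^-1 * q k ^+ 2 + -1; pose phi2 (_ l : K) := m^-1 * q l ^+ 2 + -1.
have phi1_0 : pair_expect p phi1 = 0 by rewrite pair_expectD pair_expectZ mfst pair_expect_cst// mulVf// subrr.
have phi2_0 : pair_expect p phi2 = 0 by rewrite pair_expectD pair_expectZ msnd pair_expect_cst// mulVf// subrr.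
pose C := (1 + eps^-1) / 2 * (pair_expect p (fun k l => phi1 k l ^+ 2) +
                              pair_expect p (fun k l => phi2 k l ^+ 2)).
have C0 : 0 <= C.
  apply: mulr_ge0; first by rewrite divr_ge0// addr_ge0// invr_ge0 ltW.
  by apply: addr_ge0; apply: (pair_expect_ge0 p0) => k l; exact: sqr_ge0.
(* The mean error due to the norms is C / n, below eps for this n; the shift by 3 meets the
   dimension condition of [H3]. *)
pose N := Num.bound (C / eps); pose n := N.+3.
have nR : C < n%:R * eps.
  have Ceps : 0 <= C / eps by rewrite divr_ge0// ltW.
  rewrite -ltr_pdivrMr//; apply: lt_le_trans (archi_boundP Ceps) _.
  by rewrite ler_nat /n -/N; do 3 apply: leqW.
have n0 : 0 < n%:R :> R by rewrite ltr0n.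
have nn0 : (n%:R : R) != 0 by rewrite gt_eqF.
pose V : finType := {ffun 'I_n -> K}.
pose W (u v : V) := prod_weight p u v.
have W0 u v : 0 <= W u v by apply: prodr_ge0.
have W1 : \sum_u \sum_v W u v = 1 := prod_weight_sum1 n p1.
pose c := (Num.sqrt (n%:R * m))^-1.
have c2 : c * c = (n%:R * m)^-1.
  by rewrite -invfM -expr2 sqr_sqrtr// mulr_ge0// ltW.
pose g (u : V) : n.-tuple R := [tuple c * tnth [tuple q (u i) | i < n] i | i < n].
have gdot u v : dotv (g u) (g v) = (n%:R * m)^-1 * \sum_i q (u i) * q (v i).
  by rewrite dotv_scale c2; congr (_ * _); apply: eq_bigr => i _; rewrite !tnth_mktuple.
have gnorm u : normv (g u) ^+ 2 - 1 = n%:R^-1 * \sum_i (m^-1 * q (u i) ^+ 2 + -1).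
  rewrite normv_sqr gdot big_split /= -mulr_sumr sumr_const card_ord.
  have -> : \sum_i q (u i) * q (u i) = \sum_i q (u i) ^+ 2.
    by apply: eq_bigr => i _; rewrite expr2.
  rewrite -[(-1) *+ n]mulr_natr; move: (n%:R : R) nn0 => z z0.
  by field; rewrite z0 mn0.
(* A word may have all its letters of value 0, yet its vertex needs a unit vector; hence [polar] and
   a choice. *)
have Hpolar u : exists w : n.-tuple R, dotv w w = 1 /\
    g u = [tuple normv (g u) * tnth w i | i < n].
  by have [w w1 wE] := polar (g u); exists w.
have [w Hw] := choice Hpolar; pose w1 u := (Hw u).1.
have gw u v : dotv (g u) (g v) = normv (g u) * normv (g v) * dotv (w u) (w v).
  by rewrite -dotv_scale -(Hw u).2 -(Hw v).2.
have key u v : dotv (w u) (w v) <= dotv (g u) (g v) + eps +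
    (1 + eps^-1) / 2 * ((normv (g u) ^+ 2 - 1) ^+ 2 + (normv (g v) ^+ 2 - 1) ^+ 2).
  by rewrite gw; apply: dotv_polar_le; rewrite ?w1 ?sqrtr_ge0.
have Wdot : pair_expect W (fun u v => dotv (g u) (g v)) < rho + eps.
  rewrite (eq_pair_expect _ gdot) pair_expectZ.
  have -> : pair_expect W (fun u v => \sum_i q (u i) * q (v i)) =
      n%:R * pair_expect p (fun k l => q k * q l).
    exact: (prod_weight_mean n p1 (fun k l => q k * q l)).
  by rewrite invfM mulrACA mulVf// mul1r mulrC ltr_pdivrMr.
have Wvar phi (h : V -> V -> R) : pair_expect p phi = 0 ->
    (forall u v, h u v = n%:R^-1 * \sum_i phi (u i) (v i)) ->
    pair_expect W (fun u v => h u v ^+ 2) =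
    n%:R^-1 * pair_expect p (fun k l => phi k l ^+ 2).
  move=> phi0 hE.
  rewrite (eq_pair_expect _ (b := fun u v : V => n%:R^-1 ^+ 2 *
    (\sum_i phi (u i) (v i)) ^+ 2)); last by move=> u v; rewrite hE exprMn.
  rewrite pair_expectZ.
  have -> : pair_expect W (fun u v => (\sum_i phi (u i) (v i)) ^+ 2) =
      n%:R * pair_expect p (fun k l => phi k l ^+ 2).
    exact: prod_weight_var.
  by rewrite mulrA expr2 divfK.
have Wwdot : pair_expect W (fun u v => dotv (w u) (w v)) <= rho + 3 * eps.
  apply: (le_trans (le_pair_expect W0 key)).
  rewrite !pair_expectD pair_expectZ pair_expectD pair_expect_cst//.
  rewrite (Wvar phi1 _ phi1_0 (fun u _ => gnorm u)).
  rewrite (Wvar phi2 (fun _ v => _) phi2_0 (fun _ v => gnorm v)).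
  rewrite -mulrDr mulrCA -/C.
  have : n%:R^-1 * C <= eps by rewrite mulrC ler_pdivrMr// mulrC ltW.
  by move: Wdot; lra.
have WD : 1 - rho - 3 * eps <= \sum_u \sum_v W u v * (1 - dotv (w u) (w v)).
  rewrite -[leRHS]/(pair_expect W (fun u v => 1 - dotv (w u) (w v))).
  rewrite (eq_pair_expect _ (b := fun u v => 1 + (-1) * dotv (w u) (w v))); last first.
    by move=> u v; rewrite mulN1r.
  by rewrite pair_expectD pair_expectZ pair_expect_cst//; move: Wwdot; lra.
(* Loops contribute 0 and other pairs at most twice their weight, so the positive value in [WD]
   forces mass off the diagonal. *)
have diag_lt1 : \sum_u W u u < 1.
  have : \sum_u \sum_v W u v * (1 - dotv (w u) (w v)) <=
      2 * \sum_u (\sum_v W u v - W u u).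
    rewrite mulr_sumr; apply: ler_sum => u _; rewrite (bigD1 u)//= w1 subrr mulr0 add0r.
    rewrite [X in X - _](bigD1 u)//= addrAC subrr add0r mulr_sumr; apply: ler_sum => v _.
    rewrite mulrC ler_wpM2r//.
    have /andP[] : -1 <= dotv (w u) (w v) <= 1 by apply: dotv_unit_bound; rewrite w1.
    by lra.
  by rewrite sumrB W1; move: WD gap; lra.
have [G [X [X0 GE]]] := loopless_graph W0 W1 diag_lt1.
exists V, G, X; split => //.
- apply: ge_sup; first exact: (vals_nonempty G).
  move=> _ [f /= f1 <-]; rewrite GE; last by move=> v; apply/normv_eq1.
  rewrite ler_pM2l//.
  pose F (x : n.-tuple R) := f (cell kap x).
  have mF : measurable_fun [set: n.-tuple mR] (F : n.-tuple mR -> 3.-tuple mR).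
    apply/measurable_fun_tnthP => i.
    by case: (bmeas_cell bk (fun u : V => tnth (f u) i)).
  have F1 x : normv (F x) <= 1 by rewrite /F f1.
  have := h3 n isT rho rho01 F mF F1.
  rewrite Stab_fopt3.
  have bP := bmeas_cell_pair rho bk (fun u v : V => dotv (f u) (f v)).
  have -> : Stab rho F = pair_expect W (fun u v => dotv (f u) (f v)).
    rewrite /Stab -[RHS](cell_pair_expect rho bk (fun u v : V => dotv (f u) (f v))).
    rewrite -gauss_expE; last exact: (bmeas_expect _ bP).
    apply: eq_gauss_exp => x.
    by rewrite -gauss_expE//; exact: (bmeas_section x bP).
  rewrite -[X in _ -> X <= _]/(pair_expect W (fun u v => 1 - dotv (f u) (f v))).
  rewrite (eq_pair_expect _ (a := fun u v => 1 - _)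
    (b := fun u v => 1 + (-1) * dotv (f u) (f v))); last first.
    by move=> u v; rewrite mulN1r.
  by rewrite pair_expectD pair_expectZ pair_expect_cst//; lra.
- have nV : (n <= #|V|)%N.
    rewrite card_ffun card_ord ltnW// (leq_trans (ltn_expl n (ltnSn 1)))//.
    by rewrite leq_exp2r.
  pose f v := padv #|V| (w v).
  have fE u v : dotv (f u) (f v) = dotv (w u) (w v) by exact: dotv_padv.
  apply: (@le_trans _ _ (prod_val G f)).
    rewrite GE; last by move=> v; rewrite fE.
    rewrite ler_pM2l//; apply: (le_trans WD); apply: ler_sum => u _.
    by apply: ler_sum => v _; rewrite fE.
  by apply: prod_val_le_SDP => v; rewrite fE w1.
Qed.

(** Any lower bound I on the ratios passes through a hard instance: X cancels and eps tends to 0. *)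
Lemma ratio_lower_bound_le (I rho : R) : @H3 R -> 0 <= I ->
  (forall (V : finType) (G : @wgraph R V), I <= Prod G / SDP_Prod G) ->
  -1 <= rho <= 0 -> I * (1 - rho) <= 1 - Fstar 3 rho.
Proof.
move=> h3 I0 Ile rho01; apply/ler_addgt0Pr => e e0.
(* This makes the loss 3 eps I at most e; I + 1 is positive even when I is 0. *)
pose eps := e / (3 * (I + 1)).
have I1 : 0 < I + 1 by lra.
have eps0 : 0 < eps by rewrite divr_gt0// mulr_gt0.
have Ieps : I * (3 * eps) <= e.
  have -> : I * (3 * eps) = e * (I / (I + 1)) by rewrite /eps; field; rewrite gt_eqF.
  by rewrite ler_piMr ?ltW// ltr_pdivrMr// mul1r; lra.
suff : I * (1 - rho - 3 * eps) <= 1 - Fstar 3 rho by lra.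
have F1 := Fstar_le1 3 rho.
(* When the gap is not positive no instance is available, but the left side is then at most 0. *)
have [gap|gap] := ltP 0 (1 - rho - 3 * eps); last first.
  by apply: (@le_trans _ _ 0); [rewrite mulr_ge0_le0|rewrite subr_ge0].
have [V [G [X [X0 Ple Sge]]]] := hard_instance h3 rho01 eps0 gap.
have := Ile V G; rewrite ler_pdivlMr ?SDP_Prod_gt0// => IG.
rewrite -(ler_pM2l X0) mulrCA; apply: le_trans Ple; apply: le_trans IG.
by rewrite ler_wpM2l.
Qed.

End hard_instance.

Theorem theorem2p8 (R : realType) :
  @H3 R -> inf (@ratios R) = @alpha_BOV R.
Proof.
move=> h3.
have lb : lbound (@ratios R) alpha_BOV.
  by move=> _ [V [G ->]]; exact: alpha_BOV_le_ratio.
(* Comparison with [inf] requires a nonempty set; rho = 0 and eps = 1/6 leave the gap 1/2 and supply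
   a graph. *)
have ratios0 : @ratios R !=set0.
  have gap : 0 < 1 - 0 - 3 * 6^-1 :> R by lra.
  have r0 : -1 <= (0 : R) <= 0 by rewrite lexx lerN10.
  have e0 : 0 < 6^-1 :> R by rewrite invr_gt0.
  have [V [G _]] := hard_instance h3 r0 e0 gap.
  by exists (Prod G / SDP_Prod G), V, G.
have aI : alpha_BOV <= inf (@ratios R) by exact: lb_le_inf.
apply/eqP; rewrite eq_le aI andbT.
have I0 : 0 <= inf (@ratios R) := le_trans (@alpha_BOV_ge0 R) aI.
have Ile (V : finType) (G : @wgraph R V) : inf (@ratios R) <= Prod G / SDP_Prod G.
  by apply: ge_inf; [exists alpha_BOV|exists V, G].
apply: lb_le_inf; first by exists ((1 - Fstar 3 0) / (1 - 0)), 0 => //=; lra.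
move=> _ [rho /= /andP[rho0 rho1] <-]; rewrite ler_pdivlMr ?subr_gt0//.
have [rneg|rpos] := leP rho 0.
  by apply: ratio_lower_bound_le; rewrite // rho0.
(* At rho = 0 the bound reads inf <= 1 - [Fstar] 3 0, and [Fstar] 3 0 is nonnegative. *)
have I1 : inf (@ratios R) <= 1.
  have r0 : -1 <= (0 : R) <= 0 by rewrite lexx lerN10.
  have := ratio_lower_bound_le h3 I0 Ile r0; rewrite subr0 mulr1 => H.
  by have := @Fstar0_ge0 R 3; lra.
have r01 : 0 <= rho <= 1 by rewrite !ltW.
have := Fstar_le_id 3 r01; nra.
Qed.
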